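(* Let $m\ge 1$, let $V_1,\dots,V_m,V=V_{m+1}$ be finite-dimensional Hermitian vector spaces, $d_i:=\dim(V_i)$, and let $F:=\bigoplus_{i=1}^m \mathrm{Hom}(V_i,V_{i+1})$, with $K:=\prod_{i=1}^m U(V_i)$ acting on $F$ by $$(g_1,\dots,g_m)\cdot(f_1,\dots,f_m)=(g_2 f_1 g_1^{-1},\dots,g_m f_{m-1}g_{m-1}^{-1},\,f_m g_m^{-1}).$$ For $t=(t_1,\dots,t_m)\in\mathbb{R}^m$ let $\mu_t$ be the moment map of this action whose $i$-th component is $$\mu_t(f)_i=\tfrac{i}{2}\bigl(f_i^*\circ f_i-f_{i-1}\circ f_{i-1}^*\bigr)-i\,t_i\,\mathrm{id}_{V_i},\qquad 1\le i\le m,$$ with the convention that the term $f_0\circ f_0^*$ is zero (here the factors $\tfrac{i}{2}$ and $i\,t_i$ contain the imaginary unit). Suppose that $t_i>0$ for all $1\le i\le m$. 1. For every $f=(f_1,\dots,f_m)\in F$ the following conditions are equivalent: (a) $f$ is $\mu_t$-semistable; (b) $f$ is $\mu_t$-stable; (c) all the maps $f_i$, $1\le i\le m$, are injective. 2. The map $w: f\mapsto (W_i(f))_{1\le i\le m}$, where $W_i(f):=(f_m\circ\dots\circ f_i)(V_i)\subset V$, induces an identification (diffeomorphism) of the symplectic quotient $F_{\mu_t}=\mu_t^{-1}(0)/K$ with the flag manifold $$\mathbb{F}_{d_1,\dots,d_m}(V)=\{(W_1,\dots,W_m)\mid W_1\subset\dots\subset W_m\subset V \text{ linear subspaces},\ 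\dim(W_i)=d_i\}.$$
   Context: $U(W)$ denotes the unitary group of a Hermitian vector space $W$, $\mathrm{Herm}(W)$ the real vector space of Hermitian endomorphisms of $W$, and $f^*$ the adjoint of a linear map $f$ between Hermitian vector spaces. The space $F$ carries the natural Hermitian (hence Kähler) structure. The Lie algebra $\mathfrak{k}$ of $K$ is $\bigoplus_{i=1}^m \mathfrak{u}(V_i)$, so that $i\mathfrak{k}=\bigoplus_{i=1}^m\mathrm{Herm}(V_i)$; $\mathfrak{k}$ is identified with its dual by the standard trace inner product, so that moment maps take values in $\bigoplus_{i=1}^m\mathfrak{u}(V_i)$. Each $W_i(f)$ satisfies $W_i(f)\subset W_{i+1}(f)$, and $f\mapsto (W_i(f))_i$ is constant on $K$-orbits (and on orbits of the complexification $\prod_{i=1}^m GL(V_i)$ of $K$). Stability. For $\xi=(\xi_1,\dots,\xi_m)\in i\mathfrak{k}$, let $\alpha_*(\xi)\in\mathrm{Herm}(F)$ be the Hermitian endomorphism induced by the infinitesimal action, i.e. $$\alpha_*(\xi)(f_1,\dots,f_m)=(\xi_2 f_1-f_1\xi_1,\ \dots,\ \xi_m f_{m-1}-f_{m-1}\xi_{m-1},\ -f_m\xi_m),$$ and let $\mathrm{Eig}(\alpha_*(\xi),y)$ be its eigenspace for the real number $y$. A vector $f\in F$ is $\mu_t$-stable (respectively $\mu_t$-semistable) if and only if for every $\xi\in i\mathfrak{k}\setminus\{0\}$ with $f\in\bigoplus_{y\le 0}\mathrm{Eig}(\alpha_*(\xi),y)$ one has $$\langle t,\xi\rangle:=\sum_{i=1}^m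 t_i\,\mathrm{Tr}(\xi_i)>0\qquad(\text{respectively }\ge 0).$$ *)

(* Defs.v *)
From HB Require Import structures.
From mathcomp Require Import all_boot all_order all_algebra.
From mathcomp Require Import complex.
From mathcomp Require Import all_classical all_reals all_analysis.

Set Implicit Arguments.
Unset Strict Implicit.
Unset Printing Implicit Defensive.

Import Order.TTheory GRing.Theory Num.Theory Num.Def.
Import numFieldNormedType.Exports.

Local Open Scope classical_set_scope.
Local Open Scope ring_scope.
Local Open Scope complex_scope.

Record hermSpace (R : realType) := HermSpace {
  hs_car :> vectType R[i];
  hs_dot : {dot hs_car for (@conjC R[i])} }.

Arguments hs_dot {R h}.

Section Adjoint.
Variables (R : realType) (U W : hermSpace R).

Definition is_adjoint (f : 'Hom(U, W)) (g : 'Hom(W, U)) :=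
  forall u w, hs_dot (f u) w = hs_dot u (g w).

Definition adj (f : 'Hom(U, W)) : 'Hom(W, U) := xget 0 [set g | is_adjoint f g].

(* Adjoints exist: the default value [0] in [adj] is never used. *)
Lemma adjP (f : 'Hom(U, W)) : is_adjoint f (adj f).
Proof.
suff [g fg] : exists g, is_adjoint f g by rewrite /adj; case: xgetP => // /(_ g).
pose e := vbasis {:U}; pose n := \dim {:U}.
have eE u : u = \sum_(i < n) coord e i u *: e`_i.
  by apply: coord_vbasis; rewrite memvf.
pose G : 'M[R[i]]_n := \matrix_(i, j) hs_dot e`_i e`_j.
have Gu : G \in unitmx.
  rewrite -row_free_unit -kermx_eq0; apply/rowV0P => a /sub_kermxP aG0.
  pose x : U := \sum_(i < n) a 0 i *: e`_i.
  have xe (j : 'I_n) : hs_dot x e`_j = 0.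
    move/matrixP: aG0 => /(_ 0 j); rewrite !mxE => <-.
    rewrite linear_sumlz; apply: eq_bigr => i _.
    by rewrite linearZl_LR /= !mxE.
  have x0 : x = 0.
    apply/eqP; rewrite -(dnorm_eq0 hs_dot) {2}(eE x) linear_sumr.
    by rewrite big1 // => j _; rewrite linearZr_LR /= xe mulr0.
  apply/rowP => i; rewrite mxE.
  by move/freeP: (basis_free (vbasisP {:U})) => /(_ _ x0).
pose g0 (w : W) : U :=
  \sum_(k < n) conjC (\sum_(i < n) invmx G k i * hs_dot (f e`_i) w) *: e`_k.
have g0_lin : linear g0.
  move=> a v w; rewrite /g0 scaler_sumr -big_split; apply: eq_bigr => k _ /=.
  rewrite scalerA -scalerDl; congr (_ *: _).
  rewrite !rmorph_sum /= mulr_sumr -big_split; apply: eq_bigr => i _ /=.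
  rewrite linearDr linearZr_LR /= mulrDr rmorphD /= mulrCA rmorphM /= conjCK.
  by [].
pose gL := GRing.isLinear.Build _ _ _ _ g0 g0_lin.
pose g1 : {linear W -> U} := HB.pack g0 gL.
exists (linfun g1) => u w; rewrite lfunE /= (eE u).
rewrite linear_sum !linear_sumlz; apply: eq_bigr => i _.
rewrite linearZ /= !linearZl_LR /=; congr (_ * _).
rewrite /g0 linear_sumr /=.
transitivity ((G *m (invmx G *m \col_j hs_dot (f e`_j) w)) i 0).
  by rewrite mulKVmx // mxE.
rewrite mxE; apply: eq_bigr => k _; rewrite linearZr_LR /= conjCK mulrC.
by congr (_ * _); rewrite !mxE //; apply: eq_bigr => j _; rewrite !mxE.
Qed.

End Adjoint.

Section SmoothMaps.
Variables (R : realType) (E E' : normedModType R).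

Fixpoint Ck (k : nat) (O : set E) (g : E -> E') : Prop :=
  match k with
  | 0 => forall x, O x -> {for x, continuous g}
  | k'.+1 => (forall x, O x -> differentiable g x) /\
             (forall v, Ck k' O (fun x => 'd g x v))
  end.

Definition smooth_on (O : set E) (g : E -> E') := open O /\ forall k, Ck k O g.

End SmoothMaps.

Record chart (R : realType) (X : Type) := Chart {
  chart_dom : set X;
  chart_dim : nat;
  chart_map : X -> 'rV[R]_chart_dim }.

(* A set of points with its maximal atlas. *)
Record smooth_space (R : realType) (X : Type) := SmoothSpace {
  points : set X;
  atlas : set (chart R X) }.

(* No separate charted-space hypothesis is needed: [smooth_map] itself requires
   every point of [M], and its image, to lie in the domain of a chart. *)
Definition smooth_map (R : realType) (X Y : Type)
    (M : smooth_space R X) (N : smooth_space R Y) (h : X -> Y) :=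
  forall x, points M x -> exists (c : chart R X) (c' : chart R Y),
    [/\ atlas M c, atlas N c', chart_dom c x,
        (forall y, chart_dom c y -> chart_dom c' (h y)) &
        exists g : 'rV[R]_(chart_dim c) -> 'rV[R]_(chart_dim c'),
          smooth_on (chart_map c @` chart_dom c) g /\
          forall y, chart_dom c y -> g (chart_map c y) = chart_map c' (h y)].

Definition diffeomorphism (R : realType) (X Y : Type)
    (M : smooth_space R X) (N : smooth_space R Y) (h : X -> Y) :=
  [/\ set_bij (points M) (points N) h, smooth_map M N h &
      exists2 h' : Y -> X,
        (forall x, points M x -> h' (h x) = x) & smooth_map N M h'].

(* Let [Z] be a subset of a Euclidean space, here a type [E] with a global
   coordinate system [c : E -> R^N], and let [p : E -> X] be a map, thought of as
   the projection of [Z] onto its set of classes [p @` Z].  The quotient smooth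
   structure is the one for which [p : Z -> p @` Z] is a smooth submersion: a
   chart of it is an injective map [phi] from a set [U] which is open for the
   quotient topology onto an open set of [R^k], such that [phi \o p] is smooth
   (smooth functions on [Z] being the local restrictions of smooth functions on
   the ambient space) and such that [p] has smooth local sections over [U].  Any
   two such charts are compatible. *)
Section QuotientStructure.
Variables (R : realType) (E X : Type) (N : nat) (c : E -> 'rV[R]_N).
Variables (Z : set E) (p : E -> X).

Definition smooth_in (S : set E) k (g : E -> 'rV[R]_k) :=
  forall z, S z -> exists (O : set 'rV[R]_N) (G : 'rV[R]_N -> 'rV[R]_k),
    [/\ O (c z), smooth_on O G & forall z', S z' -> O (c z') -> G (c z') = g z'].

Definition quotient_open (U : set X) :=
  exists2 O : set 'rV[R]_N, open O & forall z, Z z -> U (p z) <-> O (c z).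

Definition quotient_chart (ch : chart R X) :=
  let U := chart_dom ch in let phi := chart_map ch in
  [/\ U `<=` p @` Z, quotient_open U, set_inj U phi, open (phi @` U) &
   smooth_in (Z `&` p @^-1` U) (phi \o p) /\
   forall x, U x ->
     exists (O : set 'rV[R]_(chart_dim ch)) (s : 'rV[R]_(chart_dim ch) -> 'rV[R]_N),
       [/\ O (phi x), smooth_on O s &
           forall y, O y -> exists z, [/\ Z z, U (p z), c z = s y & phi (p z) = y]]].

Definition quotient_space : smooth_space R X :=
  SmoothSpace (p @` Z) [set ch | quotient_chart ch].

End QuotientStructure.

(* [x] continued by [z] beyond the indices [i < m]. *)
Definition extend (m : nat) (T : nat -> Type) (z : forall k, T k)
    (x : forall i : 'I_m, T i) (k : nat) : T k :=
  if @idP (k < m)%N is ReflectT lt_km then x (Ordinal lt_km) else z k.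

(* Real coordinates on a product of spaces of linear maps: real and imaginary
   parts of the entries of the matrices of the components.  Another choice of
   bases changes them by a linear isomorphism. *)
Section HomCoordinates.
Variables (R : realType) (m : nat) (A B : 'I_m -> vectType R[i]).

Definition hom_index :=
  {i : 'I_m & ('I_(\dim {:A i}) * 'I_(\dim {:B i}) * bool)%type}.

Definition hom_coord (f : forall i, 'Hom(A i, B i)) : 'rV[R]_#|{: hom_index}| :=
  \row_k let x : hom_index := enum_val k in
         let: (a, b, is_re) := tagged x in
         let z := passmx.mxof (vbasis {:A (tag x)}) (vbasis {:B (tag x)}) (f (tag x)) a b in
         if is_re then complex.Re z else complex.Im z.

End HomCoordinates.

(* The spaces [V_1, ..., V_m, V_(m+1)] are [V 0, ..., V m]; the further terms of
   the sequence [V] play no role.  Accordingly, [f_i] is [f j] with [j = i - 1]. *)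
Section Quiver.
Variables (R : realType) (m : nat) (V : nat -> hermSpace R).

Definition repF := forall i : 'I_m, 'Hom(V i, V i.+1).
Definition endos := forall i : 'I_m, 'End(V i).

Definition unitary : set endos :=
  [set g | forall (i : 'I_m) (u v : V i), hs_dot (g i u) (g i v) = hs_dot u v].

(* [g_(m+1)] is the identity. *)
Definition act (g : endos) (f : repF) : repF := fun i =>
  (extend (T := fun k => 'End(V k)) (fun k => \1) g i.+1 \o f i \o (g i)^-1)%VF.

Definition orbit (f : repF) : set repF := [set act g f | g in unitary].

Definition arrow (f : repF) (k : nat) : 'Hom(V k, V k.+1) :=
  extend (T := fun k => 'Hom(V k, V k.+1)) (fun k => 0) f k.

Definition incoming (f : repF) (k : nat) : 'End(V k) :=
  match k with
  | 0 => 0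
  | j.+1 => (arrow f j \o adj (arrow f j))%VF
  end.

Definition mu (t : 'I_m -> R) (f : repF) : endos := fun i =>
  ('i / 2%:R) *: ((adj (f i) \o f i)%VF - incoming f i) - ('i * (t i)%:C) *: \1%VF.

Definition symplectic_quotient (t : 'I_m -> R) : smooth_space R (set repF) :=
  quotient_space (@hom_coord R m (fun i => V i) (fun i => V i.+1))
    [set f | forall i, mu t f i = 0] orbit.

Definition hermitian_tuple : set endos :=
  [set xi | forall i, adj (xi i) = xi i].

(* [xi_(m+1)] is zero. *)
Definition alpha (xi : endos) (f : repF) : repF := fun i =>
  (extend (T := fun k => 'End(V k)) (fun k => 0) xi i.+1 \o f i)%VF
  - (f i \o xi i)%VF.

Definition eig (xi : endos) (y : R) : set repF :=
  [set f | forall i, alpha xi f i = y%:C *: f i].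

Definition eig_le0 (xi : endos) : set repF :=
  [set f | exists (n : nat) (y : 'I_n -> R) (v : 'I_n -> repF),
    [/\ forall j, y j <= 0, forall j, eig xi (y j) (v j) &
        forall i, f i = \sum_j v j i]].

Definition lfun_trace (W : vectType R[i]) (h : 'End(W)) : R[i] :=
  \tr (passmx.mxof (vbasis {:W}) (vbasis {:W}) h).

(* The traces are real; on [R[i]], [0 < z] means that [z] is real and positive. *)
Definition pairing (t : 'I_m -> R) (xi : endos) : R[i] :=
  \sum_i (t i)%:C * lfun_trace (xi i).

Definition stable (t : 'I_m -> R) (f : repF) :=
  forall xi, hermitian_tuple xi -> (exists i, xi i != 0) -> eig_le0 xi f ->
    0 < pairing t xi.

Definition semistable (t : 'I_m -> R) (f : repF) :=
  forall xi, hermitian_tuple xi -> (exists i, xi i != 0) -> eig_le0 xi f ->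
    0 <= pairing t xi.

(* The composition of the arrows leading from [V i] to [V j]. *)
Fixpoint comp_arrows (f : repF) (i j : nat) : 'Hom(V i, V j) :=
  if @eqP _ i j is ReflectT e then ecast k ('Hom(V i, V k)) e \1%VF
  else match j with
       | 0 => 0
       | j'.+1 => (arrow f j' \o comp_arrows f i j')%VF
       end.

Definition flag_of (f : repF) : 'I_m -> {vspace V m} :=
  fun i => limg (comp_arrows f i m).

End Quiver.

Section Flags.
Variables (R : realType) (m : nat) (d : 'I_m -> nat) (V : vectType R[i]).

Definition flags : set ('I_m -> {vspace V}) :=
  [set W | (forall i j : 'I_m, (i <= j)%N -> (W i <= W j)%VS) /\
           (forall i, \dim (W i) = d i)].

(* The flag manifold is a submanifold of the product of the Grassmannians
   [Gr(d i, V)], and [Gr(d i, V)] is the quotient of the space of injective linear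
   maps [C^(d i) -> V] by [GL(d i)], the class of such a map being its image. *)
Definition frames := forall i : 'I_m, 'Hom('rV[R[i]]_(d i), V).

Definition flag_frames : set frames :=
  [set b : frames | (forall i, injective (b i)) /\
           (forall i j : 'I_m, (i <= j)%N -> (limg (b i) <= limg (b j))%VS)].

Definition flag_manifold : smooth_space R ('I_m -> {vspace V}) :=
  SmoothSpace flags
    (atlas (quotient_space
      (@hom_coord R m (fun i => 'rV[R[i]]_(d i)) (fun=> V))
      flag_frames (fun (b : frames) i => limg (b i)))).

End Flags.

(* Main.v *)
(** Stability: an element [f] of the nonpositive part of [alpha xi] maps an
    eigenvector of [xi_i] for the eigenvalue [a] to a sum of eigenvectors of
    [xi_(i+1)] for eigenvalues at most [a].  As [xi_(m+1) = 0], injectivity of all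
    [f_i] therefore forces [xi >= 0], so that [<t, xi> > 0] unless [xi = 0].
    Conversely, if [f_i z = 0] with [z != 0], then minus the projection onto the line
    of [z] destabilizes [f].

    Quotient: [mu t f = 0] means [f_i^* f_i = 2 t_i + f_(i-1) f_(i-1)^*].  Going up
    in [i], one finds orthonormal bases of the [V_i] in which every [f_i] is a
    rectangular diagonal matrix whose entries depend on [t] and the dimensions only;
    the flag of [f] is spanned by the initial segments of the basis of [V_(m+1)].
    Two such bases with the same flag differ by a block diagonal unitary matrix,
    which commutes with the diagonal matrices: the flag determines the [K]-orbit.
    Near a given flag, flags are parametrized by the unipotent block matrices acting
    on an adapted basis; Gram-Schmidt turns the basis so obtained into an orthonormal
    one, which gives a smooth section of the projection to the flag manifold with
    values in [mu^-1(0)].  The same coordinates thus serve as chart of both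
    manifolds, and [w] is the identity in these coordinates. *)

From HB Require Import structures.
From mathcomp Require Import all_boot all_order all_algebra.
From mathcomp Require Import complex.
From mathcomp Require Import all_classical all_reals all_analysis.
Require Import Defs.

Set Implicit Arguments.
Unset Strict Implicit.
Unset Printing Implicit Defensive.

Import Order.TTheory GRing.Theory Num.Theory Num.Def.
Import numFieldNormedType.Exports.

Local Open Scope classical_set_scope.
Local Open Scope ring_scope.
Local Open Scope complex_scope.
Local Open Scope sesquilinear_scope.

(** * Calculus of smooth functions *)

Section SmoothClosure.
Variables (R : realType) (E : normedModType R) (O : set E).
Hypothesis O_open : open O.

(** The first-order expansion of [g1] at [x] is also one of [g2], and such an expansion determines
    the differential. *)
Lemma differentiable_near_eq (E' : normedModType R) (g1 g2 : E -> E') (x : E) :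
  (\forall y \near x, g1 y = g2 y) -> differentiable g1 x ->
  differentiable g2 x /\ 'd g2 x = 'd g1 x :> (E -> E').
Proof.
move=> near12 dg1.
have dg1c : continuous ('d g1 x) by exact: diff_continuous.
have g12x : g1 x = g2 x by exact: nbhs_singleton near12.
have g2x : g2 \o shift x = cst (g2 x) + 'd g1 x +o_ 0 id.
  apply/eqaddoP => _/posnumP[e].
  have /eqaddoP/(_ _ (gt0 e)) g1e := diff_locally dg1.
  have near0 : \forall h \near 0, g1 (h + x) = g2 (h + x).
    move: near12; rewrite (near_shift 0 x) /=.
    by apply: filterS => h /=; rewrite subr0.
  near=> h.
  have -> : (g2 \o shift x - (cst (g2 x) + 'd g1 x)) h =
            (g1 \o shift x - (cst (g1 x) + 'd g1 x)) h.
    have gh : g1 (h + x) = g2 (h + x) by near: h.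
    by rewrite /= -[LHS]/(g2 (h + x) - (g2 x + 'd g1 x h)) -gh -g12x.
  by near: h.
have dE : 'd g2 x = 'd g1 x :> (E -> E') by exact: diff_unique.
split=> //; apply/diff_locallyP; rewrite dE; split; [exact: dg1c|exact: g2x].
Unshelve. all: by end_near. Qed.

(** As [O] is open, equality on [O] is equality near each of its points, so the differentials agree
    on [O] too. Below, this replaces a function by an expression to which the closure rules
    apply. *)
Lemma Ck_eq (E' : normedModType R) k (g1 g2 : E -> E') :
  (forall x, O x -> g1 x = g2 x) -> Ck k O g1 -> Ck k O g2.
Proof.
have nearO (h1 h2 : E -> E') : (forall x, O x -> h1 x = h2 x) -> forall x, O x ->
    \forall y \near x, h1 y = h2 y.
  move=> h12 x Ox; apply: filterS h12 _; exact: open_nbhs_nbhs.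
elim: k g1 g2 => [|k IHk] g1 g2 g12 /=.
  move=> g1c x Ox; have g1x := g1c x Ox.
  rewrite /prop_for /continuous_at -(g12 x Ox); apply: cvg_trans g1x.
  by apply: near_eq_cvg; exact: nearO.
move=> [dg1 Cg1]; split=> [x Ox|v].
  by have [] := differentiable_near_eq (nearO _ _ g12 x Ox) (dg1 x Ox).
apply: IHk (Cg1 v) => x Ox.
by have [_ ->] := differentiable_near_eq (nearO _ _ g12 x Ox) (dg1 x Ox).
Qed.

Lemma CkW (E' : normedModType R) k (g : E -> E') : Ck k.+1 O g -> Ck k O g.
Proof.
elim: k g => [|k IHk] g [dg Cg]; first by move=> x Ox; apply/differentiable_continuous/dg.
by split => // v; apply: IHk.
Qed.

Lemma Ck_cst (E' : normedModType R) k (a : E') : Ck k O (fun=> a).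
Proof.
elim: k a => [|k IHk] a; first by move=> x _; exact: cst_continuous.
split=> [x _|v]; first exact: differentiable_cst.
by apply: Ck_eq (IHk 0) => x _; rewrite diff_cst.
Qed.

Lemma Ck_lin (E' : normedModType R) k (f : {linear E -> E'}) :
  continuous f -> Ck k O f.
Proof.
move=> fc; case: k => [|k]; first by move=> x _; exact: fc.
split=> [x _|v]; first exact: linear_differentiable.
by apply: Ck_eq (Ck_cst k (f v)) => x _; rewrite diff_lin.
Qed.

Lemma CkD (E' : normedModType R) k (f g : E -> E') :
  Ck k O f -> Ck k O g -> Ck k O (fun x => f x + g x).
Proof.
elim: k f g => [|k IHk] f g.
  by move=> fc gc x Ox; apply: continuousD; [exact: fc|exact: gc].
move=> [df Cf] [dg Cg]; split=> [x Ox|v].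
  by apply: differentiableD; [exact: df|exact: dg].
apply: Ck_eq (IHk _ _ (Cf v) (Cg v)) => x Ox.
exact/esym/(congr1 (fun h : E -> E' => h v) (diffD (df x Ox) (dg x Ox))).
Qed.

Lemma CkM k (f g : E -> R) : Ck k O f -> Ck k O g -> Ck k O (fun x => f x * g x).
Proof.
elim: k f g => [|k IHk] f g.
  by move=> fc gc x Ox; apply: continuousM; [exact: fc|exact: gc].
(* The derivative $f\,dg+g\,df$ contains [f] and [g] themselves, so both are needed at the lower
   order as well. *)
move=> Cf' Cg'; have [Cfk Cgk] := (CkW Cf', CkW Cg').
case: Cf' Cg' => [df Cf] [dg Cg]; split=> [x Ox|v].
  by apply: differentiableM; [exact: df|exact: dg].
apply: Ck_eq (CkD (IHk _ _ Cfk (Cg v)) (IHk _ _ Cgk (Cf v))) => x Ox.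
exact/esym/(congr1 (fun h : E -> R => h v) (diffM (df x Ox) (dg x Ox))).
Qed.

Lemma CkZl (E' : normedModType R) k (f : E -> R) (a : E') :
  Ck k O f -> Ck k O (fun x => f x *: a).
Proof.
elim: k f => [|k IHk] f.
  by move=> fc x Ox; apply: continuousZr_tmp; exact: fc.
move=> [df Cf]; split=> [x Ox|v].
  by apply: differentiableZl; exact: df.
by apply: Ck_eq (IHk _ (Cf v)) => x Ox; rewrite (diffZl a (df x Ox)).
Qed.

(** The derivative $-f^{-2}\,df$ contains the inverse itself one order lower, so induction on [k]
    closes. *)
Lemma CkV k (f : E -> R) : (forall x, O x -> f x != 0) ->
  Ck k O f -> Ck k O (fun x => (f x)^-1).
Proof.
move=> f0; elim: k => [|k IHk] => [fc x Ox|Cf'].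
  by apply: continuousV; [exact: f0|exact: fc].
have Cfk := CkW Cf'; case: Cf' => [df Cf]; split=> [x Ox|v].
  by apply: differentiableV; [exact: df|exact: f0].
apply: Ck_eq (CkM (CkM (Ck_cst k (-1 : R)) (CkM (IHk Cfk) (IHk Cfk))) (Cf v)) => x Ox.
apply/esym/(etrans (congr1 (fun h : E -> R => h v) (diffV (df x Ox) (f0 x Ox)))).
by rewrite mulN1r -invfM -expr2.
Qed.

(** The same induction as for [CkV], the derivative being $df/(2\sqrt f)$. *)
Lemma Ck_sqrt k (f : E -> R) : (forall x, O x -> 0 < f x) ->
  Ck k O f -> Ck k O (fun x => Num.sqrt (f x)).
Proof.
move=> f0; elim: k => [|k IHk] => [fc x Ox|Cf'].
  by apply: continuous_comp; [exact: fc|exact: sqrt_continuous].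
have dsqrt x : O x -> differentiable (Num.sqrt : R -> R) (f x).
  by move=> Ox; apply/derivable1_diffP; have [] := is_derive1_sqrt (f0 x Ox).
have s0 x : O x -> Num.sqrt (f x) != 0.
  by move=> Ox; rewrite gt_eqF // sqrtr_gt0 f0.
have Cfk := CkW Cf'; case: Cf' => [df Cf]; split=> [x Ox|v].
  by apply: differentiable_comp; [exact: df|exact: dsqrt].
apply: Ck_eq (CkM (CkM (Ck_cst k (2^-1 : R)) (CkV s0 (IHk Cfk))) (Cf v)) => x Ox.
apply/esym/(etrans (congr1 (fun h : E -> R => h v) (diff_comp (df x Ox) (dsqrt x Ox)))).
have dE := deriv1E ((derivable1_diffP _ _).2 (dsqrt x Ox)).
apply/(etrans (congr1 (fun h : R -> R => h ('d f x v)) dE)).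
by rewrite derive1E (derive_sqrt (f0 x Ox)) -invfM; exact: mulrC.
Qed.

End SmoothClosure.

(** * Smooth complex-valued and matrix-valued functions of real variables *)

Section ComplexSmooth.
Variables (R : realType) (E : normedModType R) (O : set E).
Hypothesis O_open : open O.

(** Smoothness is meant over the reals, so that conjugation preserves it. *)
Definition csmooth (F : E -> R[i]) := forall k,
  Ck k O (fun x => complex.Re (F x)) /\ Ck k O (fun x => complex.Im (F x)).

Lemma csmooth_eq (F G : E -> R[i]) :
  (forall x, O x -> F x = G x) -> csmooth F -> csmooth G.
Proof.
move=> FG CF k; have [CR CI] := CF k.
by split; [apply: Ck_eq CR => // | apply: Ck_eq CI => //] => x Ox; rewrite FG.
Qed.

Lemma csmooth_cst (a : R[i]) : csmooth (fun=> a).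
Proof. by move=> k; split; exact: Ck_cst. Qed.

Lemma csmooth_real (f : E -> R) : (forall k, Ck k O f) -> csmooth (fun x => (f x)%:C).
Proof. by move=> Cf k; split; [exact: Cf|exact: Ck_cst]. Qed.

Lemma csmoothD (F G : E -> R[i]) :
  csmooth F -> csmooth G -> csmooth (fun x => F x + G x).
Proof.
move=> CF CG k; have [[FR FI] [GR GI]] := (CF k, CG k).
split; [apply: Ck_eq (CkD O_open FR GR)|apply: Ck_eq (CkD O_open FI GI)] => // x _;
  by rewrite raddfD.
Qed.

Lemma csmoothM (F G : E -> R[i]) :
  csmooth F -> csmooth G -> csmooth (fun x => F x * G x).
Proof.
move=> CF CG k; have [[FR FI] [GR GI]] := (CF k, CG k).
split.
- apply: Ck_eq (CkD O_open (CkM O_open FR GR)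
    (CkM O_open (Ck_cst O_open k (-1 : R)) (CkM O_open FI GI))) => // x _.
  by case: (F x) (G x) => [a b] [c d] /=; rewrite mulN1r.
- apply: Ck_eq (CkD O_open (CkM O_open FR GI) (CkM O_open FI GR)) => // x _.
  by case: (F x) (G x) => [a b] [c d] /=.
Qed.

Lemma csmooth_conj (F : E -> R[i]) : csmooth F -> csmooth (fun x => (F x)^*).
Proof.
move=> CF k; have [FR FI] := CF k.
split; first by apply: Ck_eq FR => // x _; case: (F x).
apply: Ck_eq (CkM O_open (Ck_cst O_open k (-1 : R)) FI) => // x _.
by case: (F x) => a b /=; rewrite mulN1r.
Qed.

(** Reduction to the real case by $F^{-1}=|F|^{-2}\,\bar F$. *)
Lemma csmoothV (F : E -> R[i]) : (forall x, O x -> F x != 0) ->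
  csmooth F -> csmooth (fun x => (F x)^-1).
Proof.
move=> F0 CF; have CN : csmooth (fun x => (F x) * (F x)^*).
  by apply: csmoothM => //; exact: csmooth_conj.
apply: (@csmooth_eq (fun x => ((complex.Re (F x * (F x)^*))^-1)%:C * (F x)^*)).
  move=> x Ox; have nz : F x * (F x)^* != 0 by rewrite mulf_neq0 ?conjc_eq0 ?F0.
  have -> : ((complex.Re (F x * (F x)^*))^-1)%:C = (F x * (F x)^*)^-1.
    rewrite fmorphV /=; congr (_^-1); apply: RRe_real.
    by rewrite ger0_real // mulcJ_ge0.
  by rewrite invfM -mulrA mulVf ?mulr1 ?conjc_eq0 ?F0.
apply: csmoothM; last exact: csmooth_conj.
apply: csmooth_real => k; have [CR _] := CN k; apply: CkV => // x Ox.
have nz : F x * (F x)^* != 0 by rewrite mulf_neq0 ?conjc_eq0 ?F0.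
apply: contra_neq nz => R0; rewrite -[LHS]RRe_real ?R0 //.
by rewrite ger0_real // mulcJ_ge0.
Qed.

Lemma csmooth_sqrt (F : E -> R[i]) : (forall x, O x -> 0 < F x) -> csmooth F ->
  csmooth (fun x => (Num.sqrt (complex.Re (F x)))%:C).
Proof.
move=> F0 CF; apply: csmooth_real => k; have [CR _] := CF k.
by apply: Ck_sqrt => // x Ox; have := F0 x Ox; rewrite ltcE => /andP[].
Qed.

Lemma csmooth_sum (I : Type) (r : seq I) (P : pred I) (F : I -> E -> R[i]) :
  (forall i, csmooth (F i)) -> csmooth (fun x => \sum_(i <- r | P i) F i x).
Proof.
move=> CF; elim: r => [|i r IHr].
  by apply: csmooth_eq (csmooth_cst 0) => x _; rewrite big_nil.
case Pi: (P i).
  by apply: csmooth_eq (csmoothD (CF i) IHr) => x _; rewrite big_cons Pi.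
by apply: csmooth_eq IHr => x _; rewrite big_cons Pi.
Qed.

Lemma csmooth_prod (I : Type) (r : seq I) (P : pred I) (F : I -> E -> R[i]) :
  (forall i, csmooth (F i)) -> csmooth (fun x => \prod_(i <- r | P i) F i x).
Proof.
move=> CF; elim: r => [|i r IHr].
  by apply: csmooth_eq (csmooth_cst 1) => x _; rewrite big_nil.
case Pi: (P i).
  by apply: csmooth_eq (csmoothM (CF i) IHr) => x _; rewrite big_cons Pi.
by apply: csmooth_eq IHr => x _; rewrite big_cons Pi.
Qed.

(** The condition amounts to positivity of the continuous real function $|F|^2$. Applied to
    determinants, it makes the chart domains open. *)
Lemma csmooth_open_neq0 (F : E -> R[i]) : csmooth F -> open (O `&` [set x | F x != 0]).
Proof.
move=> CF; have Cn : csmooth (fun x => F x * (F x)^*).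
  by apply: csmoothM => //; exact: csmooth_conj.
rewrite openE => x [Ox Fx0].
have [Cc _] := Cn 0%N; have cx := Cc x Ox.
have nz : F x * (F x)^* != 0 by rewrite mulf_neq0 ?conjc_eq0.
have gt0x : 0 < complex.Re (F x * (F x)^*).
  have : 0 < F x * (F x)^* by rewrite lt0r nz mulcJ_ge0.
  by rewrite ltcE => /andP[].
have near_gt : \forall y \near x, 0 < complex.Re (F y * (F y)^*).
  exact: cvgr_gt cx _ gt0x.
rewrite /interior; apply: filterI; first exact: open_nbhs_nbhs.
apply: filterS near_gt => y /= ygt; apply: contraTneq ygt => ->.
by rewrite mul0r ltxx.
Qed.

Definition msmooth p q (F : E -> 'M[R[i]]_(p, q)) :=
  forall i j, csmooth (fun x => F x i j).

Lemma msmooth_eq p q (F G : E -> 'M[R[i]]_(p, q)) :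
  (forall x, O x -> F x = G x) -> msmooth F -> msmooth G.
Proof.
by move=> FG CF i j; apply: csmooth_eq (CF i j) => x Ox; rewrite FG.
Qed.

Lemma msmooth_cst p q (A : 'M[R[i]]_(p, q)) : msmooth (fun=> A).
Proof. by move=> i j; exact: csmooth_cst. Qed.

Lemma msmoothM p q r (F : E -> 'M[R[i]]_(p, q)) (G : E -> 'M[R[i]]_(q, r)) :
  msmooth F -> msmooth G -> msmooth (fun x => F x *m G x).
Proof.
move=> CF CG i j.
apply: (@csmooth_eq (fun x => \sum_k F x i k * G x k j)) => [x _|]; first by rewrite mxE.
by apply: csmooth_sum => k; exact: csmoothM.
Qed.

Lemma msmoothB p q (F G : E -> 'M[R[i]]_(p, q)) :
  msmooth F -> msmooth G -> msmooth (fun x => F x - G x).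
Proof.
move=> CF CG i j.
apply: (@csmooth_eq (fun x => F x i j + (-1) * G x i j)) => [x _|].
  by rewrite mulN1r !mxE.
by apply: csmoothD => //; apply: csmoothM => //; exact: csmooth_cst.
Qed.

Lemma msmooth_trC p q (F : E -> 'M[R[i]]_(p, q)) :
  msmooth F -> msmooth (fun x => (F x)^t*).
Proof.
move=> CF i j; apply: csmooth_eq (csmooth_conj (CF j i)) => x _.
by rewrite !mxE.
Qed.

Lemma csmooth_det p (F : E -> 'M[R[i]]_p) :
  msmooth F -> csmooth (fun x => \det (F x)).
Proof.
move=> CF; apply: csmooth_sum => s; apply: csmoothM; first exact: csmooth_cst.
by apply: csmooth_prod => i; exact: CF.
Qed.

(** By Cramer's rule the entries of the inverse are cofactors divided by the determinant. *)
Lemma msmoothV p (F : E -> 'M[R[i]]_p) :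
  (forall x, O x -> F x \in unitmx) -> msmooth F -> msmooth (fun x => invmx (F x)).
Proof.
move=> Fu CF i j.
apply: (@csmooth_eq (fun x => (\det (F x))^-1 *
   ((-1) ^+ (j + i) * \det (row' j (col' i (F x)))))).
  by move=> x Ox; rewrite /invmx Fu // !mxE.
apply: csmoothM.
  apply: csmoothV; last exact: csmooth_det.
  by move=> x Ox; have := Fu x Ox; rewrite unitmxE unitfE.
apply: csmoothM; first exact: csmooth_cst.
apply: csmooth_det => k l; apply: csmooth_eq (CF (lift j k) (lift i l)) => x _.
by rewrite !mxE.
Qed.

(** A row is the finite sum of its entries times constant vectors, so smoothness can be tested entry
    by entry. *)
Lemma smooth_on_row q (g : E -> 'rV[R]_q) :
  (forall k i, Ck k O (fun x => g x 0 i)) -> smooth_on O g.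
Proof.
move=> Cg; split=> // k.
have C (r : seq 'I_q) :
    Ck k O (fun x => \sum_(i <- r) g x 0 i *: (delta_mx 0 i : 'rV[R]_q)).
  elim: r => [|i r IHr].
    by apply: Ck_eq (Ck_cst O_open k 0) => // x _; rewrite big_nil.
  apply: Ck_eq (CkD O_open (CkZl O_open _ (Cg k i)) IHr) => // x _.
  by rewrite big_cons.
by apply: Ck_eq (C (index_enum _)) => // x _; rewrite [RHS]row_sum_delta.
Qed.

End ComplexSmooth.

Lemma csmoothS (R : realType) (E : normedModType R) (O O' : set E) (F : E -> R[i]) :
  O' `<=` O -> csmooth O F -> csmooth O' F.
Proof.
have CkS k (g : E -> R) : O' `<=` O -> Ck k O g -> Ck k O' g.
  move=> sO; elim: k g => [|k IHk] g; first by move=> gc x /sO; exact: gc.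
  by move=> [dg Cg]; split=> [x /sO|v]; [exact: dg|exact: IHk (Cg v)].
by move=> sO CF k; have [CR CI] := CF k; split; [exact: CkS CR|exact: CkS CI].
Qed.

(** * Matrices and Gram-Schmidt *)

Section PidMx.
Variable F : fieldType.

(** Left multiplication by [pid_mx p] with [p] rows keeps the first [p] rows. Initial segments of a
    basis, the rows of a matrix, are written in this way throughout. *)
Lemma row_pid_mxM p n q (k : 'I_p) (l : 'I_n) (A : 'M[F]_(n, q)) :
  (k : nat) = l -> row k ((pid_mx p : 'M[_]_(p, n)) *m A) = row l A.
Proof.
move=> kl; rewrite row_mul (_ : row k _ = delta_mx 0 l) -?rowE //.
by apply/rowP => j; rewrite !mxE /= ltn_ord andbT kl -val_eqE eq_sym.
Qed.

Lemma pid_mxM p q n r (A : 'M[F]_(n, r)) : (p <= q)%N -> (q <= n)%N ->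
  (pid_mx p : 'M[_]_(p, q)) *m ((pid_mx q : 'M[_]_(q, n)) *m A) = (pid_mx p : 'M[_]_(p, n)) *m A.
Proof.
move=> pq qn; rewrite mulmxA mul_pid_mx; congr (pid_mx _ *m _).
by rewrite (minn_idPl pq) (minn_idPr pq).
Qed.

Lemma row_free_pid_mxM p n (E : 'M[F]_n) :
  (p <= n)%N -> E \in unitmx -> row_free ((pid_mx p : 'M[_]_(p, n)) *m E).
Proof.
move=> pn Eu; rewrite /row_free mxrankMfree ?row_free_unit //.
by rewrite rank_pid_mx.
Qed.

Lemma row_free_complete p n (A : 'M[F]_(p, n)) : row_free A ->
  exists2 Y, Y \in unitmx & (pid_mx p : 'M[_]_(p, n)) *m Y = A.
Proof.
move=> Af; have rA : \rank A = p by exact/eqP.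
have pn : (p <= n)%N by rewrite -rA rank_leq_col.
pose J : 'M[F]_(p, n) := pid_mx p; pose J' : 'M[F]_(n, p) := pid_mx p.
have JJ' : J *m J' = 1%:M.
  by rewrite mul_pid_mx minnn (minn_idPr pn) pid_mx_1.
have [Q [QJ' JQ QQ JQ1]] : exists Q : 'M[F]_n,
    [/\ Q *m J' = 0, J *m Q = 0, Q *m Q = Q & J' *m J + Q = 1%:M].
  exists (copid_mx p); rewrite copid_mx_id // mul_pid_mx !minnn.
  split=> //; last by rewrite /copid_mx addrC subrK.
    by rewrite /copid_mx mulmxBl mul1mx mul_pid_mx minnn (minn_idPr pn) subrr.
  by rewrite /copid_mx mulmxBr mulmx1 mul_pid_mx minnn (minn_idPr pn) subrr.
(* [L x] is the block diagonal matrix with blocks [x] and the identity. It carries the left factor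
   [c] of the rank factorization of [A] to the other side of [J]. *)
pose c := col_ebase A; pose L (x : 'M[_]_p) := J' *m x *m J + Q.
have LM x y : L x *m L y = L (x *m y).
  rewrite /L mulmxDl !mulmxDr -!mulmxA JQ !mulmx0 addr0 QQ.
  by rewrite (mulmxA Q) QJ' mul0mx add0r (mulmxA J J') JJ' mul1mx.
have L1 : L 1%:M = 1%:M by rewrite /L mulmx1.
have Lcu : L c \in unitmx.
  have h : L c *m L (invmx c) = 1%:M by rewrite LM mulmxV ?col_ebase_unit.
  by have [] := mulmx1_unit h.
exists (L c *m row_ebase A); first by rewrite unitmx_mul Lcu row_ebase_unit.
rewrite -[RHS](mulmx_ebase A) rA mulmxA; congr (_ *m _).
by rewrite /L mulmxDr JQ addr0 !mulmxA JJ' mul1mx.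
Qed.

(** Reduction to [row_free_complete], applied to the coordinates of [A] in a basis of [W]. *)
Lemma row_free_complete_in p q n (A : 'M[F]_(p, n)) (W : 'M[_]_n) :
  row_free A -> (A <= W)%MS -> \rank W = q ->
  exists A' : 'M[_]_(q, n), [/\ row_free A', (pid_mx p : 'M[_]_(p, q)) *m A' = A &
     (A' :=: W)%MS].
Proof.
move=> Af AW rW; case: q / rW.
have AB : (A <= row_base W)%MS by rewrite eq_row_base.
have /submxP[c cE] := AB.
have cf : row_free c.
  by rewrite /row_free -(mxrankMfree _ (row_base_free W)) -cE.
have [Y Yu YE] := row_free_complete cf.
exists (Y *m row_base W); split.
- by rewrite /row_free mxrankMfree ?row_base_free // mxrank_unit.
- by rewrite mulmxA YE.
- apply: (eqmx_trans _ (eq_row_base W)).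
  by apply: eqmxMfull; rewrite row_full_unit.
Qed.

Lemma adapted_basis m n (d : 'I_m -> nat) (W : 'I_m -> 'M[F]_n) :
  (forall i j : 'I_m, (i <= j)%N -> (W i <= W j)%MS) ->
  (forall i, \rank (W i) = d i) ->
  exists2 E, E \in unitmx &
    forall i, ((pid_mx (d i) : 'M[_]_(d i, n)) *m E :=: W i)%MS.
Proof.
move=> Wmon Wd.
have dn i : (d i <= n)%N by rewrite -Wd rank_leq_col.
(* The basis is enlarged from one subspace to the next. Here [p] is the dimension of the last
   subspace treated, initially 0; the first [p] rows are kept at the next step, and so are the
   shorter initial segments. *)
suff /(_ m (leqnn m)) [E [p [Eu _ EW _]]] : forall k, (k <= m)%N -> exists E p,
    [/\ E \in unitmx, (p <= n)%N,
     forall i : 'I_m, (i < k)%N -> (d i <= p)%N /\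
       ((pid_mx (d i) : 'M[_]_(d i, n)) *m E :=: W i)%MS &
     forall i : 'I_m, (k <= i)%N -> ((pid_mx p : 'M[_]_(p, n)) *m E <= W i)%MS].
  by exists E => // i; have [] := EW i (ltn_ord i).
elim=> [|k IHk] km.
  exists 1%:M, 0%N; split=> // [|i _]; first exact: unitmx1.
  by rewrite pid_mx_0 mul0mx sub0mx.
have [E [p [Eu pn EW WE]]] := IHk (ltnW km).
pose K := Ordinal km.
have [A' [A'f A'E A'W]] := row_free_complete_in (row_free_pid_mxM pn Eu) (WE K (leqnn _)) (Wd K).
have [E' E'u E'E] := row_free_complete A'f.
have pK : (p <= d K)%N.
  rewrite -(eqP (row_free_pid_mxM pn Eu)) -(Wd K); exact/mxrankS/WE.
have dKW : ((pid_mx (d K) : 'M[_]_(d K, n)) *m E' :=: W K)%MS by rewrite E'E.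
exists E', (d K); split=> // i; last first.
  by move=> ki; rewrite dKW; apply: Wmon; exact: ltnW.
rewrite ltnS leq_eqVlt => /orP[/eqP ik|ik].
  by have -> : i = K by exact/val_inj.
have [dp EWi] := EW i ik; split; first exact: leq_trans pK.
apply: eqmx_trans EWi.
rewrite -(pid_mxM E dp pn) -A'E -E'E (pid_mxM E' pK (dn K)) pid_mxM //.
Qed.

End PidMx.

(** * Hermitian matrices and Gram-Schmidt orthonormalization *)

Section GramSchmidt.
Variable R : realType.
Local Notation C := R[i].

Lemma trmxC_mul p q r (A : 'M[C]_(p, q)) (B : 'M[_]_(q, r)) :
  (A *m B)^t* = B^t* *m A^t*.
Proof. by rewrite trmx_mul map_mxM. Qed.

Lemma trmxCE p q (A : 'M[C]_(p, q)) i j : A^t* i j = conjC (A j i).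
Proof. by rewrite !mxE. Qed.

Lemma trmxCZ p q a (A : 'M[C]_(p, q)) : (a *: A)^t* = conjC a *: A^t*.
Proof. by rewrite linearZ /= map_mxZ. Qed.

Lemma trmxC_inv p (A : 'M[C]_p) : (invmx A)^t* = invmx (A^t*).
Proof. by rewrite trmx_inv map_invmx. Qed.

Lemma trmxC_pid p q r : (pid_mx r : 'M[C]_(p, q))^t* = pid_mx r.
Proof. by rewrite tr_pid_mx map_pid_mx. Qed.

Lemma dotmx_gt0 n (v : 'rV[C]_n) : v != 0 -> 0 < (v *m v^t*) 0 0.
Proof. by move=> v0; rewrite -dotmxE dnorm_gt0. Qed.

Lemma row_unitary_neq0 n (U : 'M[C]_n) k : U *m U^t* = 1%:M -> row k U != 0.
Proof.
move=> UU; apply/eqP => rU0; have /matrixP/(_ k k)/esym/eqP := UU.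
rewrite [X in X == _]mxE eqxx; apply/negP; rewrite mxE big1 ?oner_eq0 // => i _.
by have /rowP/(_ i) := rU0; rewrite [LHS]mxE [RHS]mxE => ->; rewrite mul0r.
Qed.

Lemma hermitian_diag n (H : 'M[C]_n) : H^t* = H -> exists U (s : 'rV[C]_n),
  [/\ U *m U^t* = 1%:M, H = U^t* *m diag_mx s *m U & forall k, s 0 k \is Num.real].
Proof.
move=> Hh; have Hherm : H \is hermsymmx.
  by apply/is_hermitianmxP; rewrite expr0 scale1r Hh.
have sr := hermitian_spectral_diag_real Hherm.
have /orthomx_spectralP HE := hermitian_normalmx Hherm.
have Uu := spectral_unitarymx H.
exists (spectralmx H), (spectral_diag H); split; first exact/unitarymxP.
  by rewrite -invmx_unitary.
by move=> k; exact: (mxOverP sr).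
Qed.

(** In $H=U^*\mathrm{diag}(s)\,U$ the number $s_k$ is the value of the form at row [k] of [U], hence
    positive, and $P=U^*\mathrm{diag}(\sqrt s)$. For Gram matrices this yields orthonormal
    coordinates. *)
Lemma posdef_factor n (H : 'M[C]_n) : H^t* = H ->
  (forall v : 'rV[C]_n, v != 0 -> 0 < (v *m H *m v^t*) 0 0) ->
  exists2 P, P \in unitmx & H = P *m P^t*.
Proof.
move=> Hh Hpos; have [U [s [UU HE _]]] := hermitian_diag Hh.
have s_gt0 k : 0 < s 0 k.
  have := Hpos _ (row_unitary_neq0 k UU); rewrite HE -row_mul.
  have -> : U *m (U^t* *m diag_mx s *m U) = diag_mx s *m U.
    by rewrite !mulmxA UU mul1mx.
  rewrite row_mul row_diag_mx -!scalemxAl mxE -rowE.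
  suff -> : (row k U *m (row k U)^t*) 0 0 = 1 by rewrite mulr1.
  have <- : (U *m U^t*) k k = 1 by rewrite UU mxE eqxx.
  by rewrite [LHS]mxE [RHS]mxE; apply: eq_bigr => i _; rewrite !mxE.
pose r : 'rV[C]_n := \row_k sqrtC (s 0 k).
have conjr k : conjC (sqrtC (s 0 k)) = sqrtC (s 0 k).
  by apply/CrealP; rewrite ger0_real // sqrtC_ge0 ltW.
exists (U^t* *m diag_mx r).
  have [Uu _] := mulmx1_unit UU; have [_ U'u] := mulmx1_unit UU.
  rewrite unitmx_mul U'u unitmxE det_diag unitfE; apply/prodf_neq0 => i _.
  by rewrite mxE sqrtC_eq0 gt_eqF.
rewrite [LHS]HE trmxC_mul trmxCK !mulmxA; congr (_ *m _).
rewrite -[RHS]mulmxA; congr (_ *m _); apply/matrixP => i j.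
rewrite tr_diag_mx map_diag_mx mul_diag_mx !mxE; case: eqVneq => [->|_].
  by rewrite !mulr1n /= conjr -expr2 sqrtCK.
by rewrite !mulr0n mulr0.
Qed.

(** The trace is the sum of the eigenvalues, and a Hermitian matrix with vanishing eigenvalues is
    zero. *)
Lemma hermitian_mxtrace_gt0 n (H : 'M[C]_n) : H^t* = H ->
  (forall (a : R) (v : 'rV[C]_n), v != 0 -> v *m H = a%:C *: v -> 0 <= a) ->
  0 <= \tr H /\ (H != 0 -> 0 < \tr H).
Proof.
move=> Hh Heig; have [U [s [UU HE sr]]] := hermitian_diag Hh.
have s_ge0 k : 0 <= s 0 k.
  have /complex_realP[a sa] := sr k; rewrite sa ler0c.
  apply: (Heig a _ (row_unitary_neq0 k UU)).
  by rewrite HE -row_mul !mulmxA UU mul1mx row_mul row_diag_mx -scalemxAl -rowE sa.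
have trE : \tr H = \sum_k s 0 k.
  by rewrite HE mxtrace_mulC mulmxA UU mul1mx mxtrace_diag.
rewrite trE; split=> [|H0]; first exact: sumr_ge0.
rewrite lt0r sumr_ge0 // andbT; apply: contra H0 => /eqP sum0.
have s0 : s = 0.
  apply/rowP => k; rewrite [RHS]mxE; apply/eqP; move/eqP: sum0.
  by rewrite psumr_eq0 // => /allP/(_ k); rewrite mem_index_enum => /(_ isT).
by rewrite HE s0 [diag_mx _]linear0 mulmx0 mul0mx.
Qed.

(** A row [a] that kills the Gram matrix satisfies $|aA|^2=0$. *)
Lemma gram_unit p n (A : 'M[C]_(p, n)) : row_free A -> A *m A^t* \in unitmx.
Proof.
move=> Af; rewrite -row_free_unit -kermx_eq0; apply/rowV0P => a /sub_kermxP a0.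
have aA : a *m A = 0.
  apply/eqP; apply: contraT => /dotmx_gt0.
  by rewrite trmxC_mul -mulmxA (mulmxA A) mulmxA a0 mul0mx mxE ltxx.
by apply/eqP; rewrite -(mulmx_free_eq0 a Af) aA.
Qed.

(* [row k Y] minus its projection onto the span of the previous rows. *)
Definition gsv n (Y : 'M[C]_n) (k : 'I_n) : 'rV_n :=
  let A := (pid_mx k : 'M[_]_(k, n)) *m Y in
  row k Y - row k Y *m A^t* *m invmx (A *m A^t*) *m A.

(** The real square root is used so that [csmooth_sqrt] applies to the norm. *)
Definition gsnorm n (v : 'rV[C]_n) : C := (Num.sqrt (complex.Re ((v *m v^t*) 0 0)))%:C.

Definition gs n (Y : 'M[C]_n) : 'M[_]_n :=
  \matrix_(k, l) ((gsnorm (gsv Y k))^-1 * gsv Y k 0 l).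

Lemma row_gs n (Y : 'M[C]_n) k : row k (gs Y) = (gsnorm (gsv Y k))^-1 *: gsv Y k.
Proof. by apply/rowP => l; rewrite !mxE. Qed.

Lemma gsnorm_gt0 n (v : 'rV[C]_n) : v != 0 -> 0 < gsnorm v.
Proof.
by move/dotmx_gt0; rewrite ltcE => /andP[_ v0]; rewrite ltcR sqrtr_gt0.
Qed.

Lemma gsnorm_sqr n (v : 'rV[C]_n) : gsnorm v ^+ 2 = (v *m v^t*) 0 0.
Proof.
have v0 : 0 <= (v *m v^t*) 0 0 by rewrite -dotmxE dnorm_ge0.
rewrite /gsnorm -rmorphXn /= sqr_sqrtr; last by move: v0; rewrite lecE => /andP[].
by rewrite RRe_real // ger0_real.
Qed.

Section Unit.
Variables (n : nat) (Y : 'M[C]_n).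
Hypothesis Yu : Y \in unitmx.

Lemma gsv_sub p (k : 'I_n) : (k < p)%N -> (p <= n)%N ->
  (gsv Y k <= (pid_mx p : 'M[_]_(p, n)) *m Y)%MS.
Proof.
move=> kp pn; apply: addmx_sub.
  by rewrite -(@row_pid_mxM _ _ _ _ (Ordinal kp) k Y) ?row_sub.
rewrite -mulNmx; apply: submx_trans (submxMl _ _) _.
by rewrite -(pid_mxM Y (ltnW kp) pn) submxMl.
Qed.

Lemma gsv_orth (k : 'I_n) : gsv Y k *m ((pid_mx k : 'M[_]_(k, n)) *m Y)^t* = 0.
Proof.
rewrite /gsv /=; set A := _ *m Y.
have Au : A *m A^t* \in unitmx.
  by apply: gram_unit; apply: row_free_pid_mxM => //; exact: ltnW.
by clearbody A; rewrite mulmxBl -!mulmxA mulVmx // mulmx1 subrr.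
Qed.

(** Otherwise row [k] would lie in the span of the previous rows, against the ranks of the initial
    segments. *)
Lemma gsv_neq0 (k : 'I_n) : gsv Y k != 0.
Proof.
apply/eqP => v0.
have sub : (row k Y <= (pid_mx k : 'M[_]_(k, n)) *m Y)%MS.
  by move/eqP: v0; rewrite subr_eq0 => /eqP ->; rewrite submxMl.
have : ((pid_mx k.+1 : 'M[_]_(k.+1, n)) *m Y <= (pid_mx k : 'M[_]_(k, n)) *m Y)%MS.
  apply/row_subP => l; have ln : (l < n)%N by exact: leq_trans (ltn_ord l) (ltn_ord k).
  rewrite (row_pid_mxM (l := Ordinal ln)) //.
  have := ltn_ord l; rewrite ltnS leq_eqVlt => /orP[/eqP lk|lk].
    by have -> : Ordinal ln = k by exact: val_inj.
  by rewrite -(@row_pid_mxM _ _ _ _ (Ordinal lk) (Ordinal ln) Y) ?row_sub.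
move/mxrankS; rewrite !(eqP (row_free_pid_mxM _ Yu)) ?ltnn //; exact: ltnW.
Qed.

Lemma gs_unitary : gs Y \is unitarymx.
Proof.
have lt_orth (k l : 'I_n) : (l < k)%N -> gsv Y k *m (gsv Y l)^t* = 0.
  move=> lk; have /submxP[c ->] := gsv_sub lk (ltnW (ltn_ord k)).
  by rewrite trmxC_mul mulmxA gsv_orth mul0mx.
apply/unitarymxP/row_matrixP => k; apply/rowP => l.
have -> : row k (gs Y *m (gs Y)^t*) 0 l = (row k (gs Y) *m (row l (gs Y))^t*) 0 0.
  by rewrite !mxE; apply: eq_bigr => i _; rewrite !mxE.
rewrite !row_gs linearZ /= map_mxZ -scalemxAl -scalemxAr scalerA mxE [RHS]mxE [RHS]mxE.
have [kl|lk|/val_inj ->] := ltngtP k l.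
- rewrite -val_eqE /= ltn_eqF //.
  rewrite -[gsv Y k *m _]trmxCK trmxC_mul trmxCK lt_orth //.
  by rewrite trmx0 map_mx0 mxE mulr0.
- by rewrite lt_orth // mxE mulr0 -val_eqE /= gtn_eqF.
- rewrite eqxx.
  have g0 := gsnorm_gt0 (gsv_neq0 l).
  rewrite -gsnorm_sqr fmorphV /= (_ : conjC (gsnorm _) = gsnorm (gsv Y l)); last first.
    exact: conjc_real.
    by rewrite expr2 -mulrA [X in _ * X]mulrA mulVf ?mul1r ?mulVf // gt_eqF.
Qed.

Lemma gs_flag p : (p <= n)%N ->
  ((pid_mx p : 'M[_]_(p, n)) *m gs Y :=: (pid_mx p : 'M[_]_(p, n)) *m Y)%MS.
Proof.
move=> pn; apply/eqmxP.
have sub : ((pid_mx p : 'M[_]_(p, n)) *m gs Y <= (pid_mx p : 'M[_]_(p, n)) *m Y)%MS.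
  apply/row_subP => l; have ln : (l < n)%N by exact: leq_trans (ltn_ord l) pn.
  rewrite (row_pid_mxM (l := Ordinal ln)) // row_gs.
  by apply: scalemx_sub; apply: gsv_sub => //=; exact: ltn_ord.
rewrite -mxrank_leqif_eq // !(eqP (row_free_pid_mxM _ _)) //.
exact/unitarymx_unit/gs_unitary.
Qed.

(** Projections onto previous rows vanish within an orthonormal segment. Hence Gram-Schmidt, applied
    to any completion of an orthonormal family to a basis, gives an orthonormal basis that still
    starts with this family. *)
Lemma gs_id p : (p <= n)%N -> (pid_mx p : 'M[_]_(p, n)) *m Y \is unitarymx ->
  (pid_mx p : 'M[_]_(p, n)) *m gs Y = (pid_mx p : 'M[_]_(p, n)) *m Y.
Proof.
move=> pn /unitarymxP Aun; apply/row_matrixP => l.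
have ln : (l < n)%N by exact: leq_trans (ltn_ord l) pn.
pose k := Ordinal ln.
have rowYE (M : 'M[C]_n) : row l ((pid_mx p : 'M[_]_(p, n)) *m M) = row k M.
  exact: row_pid_mxM.
rewrite !rowYE row_gs; set A := _ *m Y in Aun.
have AE : row k Y = row l A by rewrite rowYE.
have orth : row k Y *m ((pid_mx k : 'M[_]_(k, n)) *m Y)^t* = 0.
  rewrite -(pid_mxM Y (ltnW (ltn_ord l)) pn) -/A AE trmxC_mul mulmxA -row_mul Aun.
  rewrite trmxC_pid row1 -rowE.
  by apply/rowP => j; rewrite !mxE gtn_eqF.
have v_row : gsv Y k = row k Y by rewrite /gsv /= orth !mul0mx subr0.
rewrite v_row (_ : gsnorm _ = 1) ?invr1 ?scale1r //.
rewrite /gsnorm (_ : (_ *m _) 0 0 = 1) ?sqrtr1 // AE.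
rewrite -[RHS](_ : (A *m A^t*) l l = 1); last by rewrite Aun mxE eqxx.
by rewrite [LHS]mxE [RHS]mxE; apply: eq_bigr => i _; rewrite !mxE.
Qed.

End Unit.
End GramSchmidt.

Section GramSchmidtSmooth.
Variables (R : realType) (E : normedModType R) (O : set E).
Hypothesis O_open : open O.

Lemma msmooth_gs n (Y : E -> 'M[R[i]]_n) :
  (forall x, O x -> Y x \in unitmx) -> msmooth O Y -> msmooth O (fun x => gs (Y x)).
Proof.
move=> Yu CY.
have Crow k : msmooth O (fun x => row k (Y x)).
  by move=> i j; apply: csmooth_eq (CY k j) => // x _; rewrite mxE.
have Cv k : msmooth O (fun x => gsv (Y x) k).
  have CA : msmooth O (fun x => (pid_mx k : 'M[_]_(k, n)) *m Y x).
    apply: msmoothM => //; exact: (msmooth_cst O_open).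
  apply: (msmoothB O_open (Crow k)).
  apply: msmoothM => //; apply: msmoothM => //.
    by apply: msmoothM => //; exact: msmooth_trC.
  apply: msmoothV => //; last by apply: msmoothM => //; exact: msmooth_trC.
  move=> x Ox; apply/gram_unit/row_free_pid_mxM; [exact: ltnW|exact: Yu].
move=> k l.
apply: (@csmooth_eq _ _ _ _ (fun x => (gsnorm (gsv (Y x) k))^-1 * gsv (Y x) k 0 l)).
- exact: O_open.
- by move=> x _; rewrite [RHS]mxE.
apply: csmoothM => //; last exact: Cv.
apply: csmoothV => // [x Ox|]; first by rewrite gt_eqF // gsnorm_gt0 // gsv_neq0 // Yu.
apply: csmooth_sqrt => // [x Ox|]; first by apply: dotmx_gt0; apply: gsv_neq0; exact: Yu.
by apply: (msmoothM _ (Cv k) (msmooth_trC _ (Cv k))).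
Qed.

End GramSchmidtSmooth.

(** * Coordinates in orthonormal bases *)

Import passmx.

Section OrthonormalCoordinates.
Variable R : realType.
Local Notation C := R[i].
Implicit Types W U : hermSpace R.

Definition gram W : 'M[C]_(\dim {:W}) :=
  \matrix_(i, j) hs_dot (vbasis {:W})`_i (vbasis {:W})`_j.

Lemma hs_dot_gram W (a b : 'rV_(\dim {:W})) :
  hs_dot (vecof (vbasis {:W}) a) (vecof (vbasis {:W}) b) =
  (a *m gram W *m b^t*) 0 0.
Proof.
rewrite -mulmxA mxE /vecof linear_sumlz; apply: eq_bigr => i _.
rewrite linearZl_LR /=; congr (_ * _).
rewrite linear_sumr mxE; apply: eq_bigr => j _.
by rewrite linearZr_LR /= !mxE mulrC.
Qed.

Lemma hs_dotC W (u v : W) : hs_dot u v = conjC (hs_dot v u).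
Proof. by rewrite hermC expr0 mul1r. Qed.

Lemma gram_factor W : exists2 P : 'M[C]_(\dim {:W}), P \in unitmx & gram W = P *m P^t*.
Proof.
apply: posdef_factor => [|v v0].
  by apply/matrixP => i j; rewrite trmxCE !mxE [RHS]hs_dotC.
by rewrite -hs_dot_gram dnorm_gt0 vecof_eq0 ?vbasisP.
Qed.

(** The change from coordinates in [vbasis {:W}] to coordinates in an orthonormal basis: after
    multiplication by it the inner product is the standard one. *)
Definition onbmx W := projT1 (cid2 (gram_factor W)).

Lemma onbmx_unit W : onbmx W \in unitmx.
Proof. by rewrite /onbmx; case: cid2. Qed.

Lemma gram_onbmx W : gram W = onbmx W *m (onbmx W)^t*.
Proof. by rewrite /onbmx; case: cid2. Qed.

(* [oco], [lmx] and [nmx] are locked because unification would otherwise unfold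
   them to matrix products, which [mulmxA] and [trmx_mul] then take apart. *)
Definition oco W (u : W) := locked (rVof (vbasis {:W}) u *m onbmx W).
Lemma ocoE W (u : W) : oco u = rVof (vbasis {:W}) u *m onbmx W.
Proof. by rewrite /oco -lock. Qed.

Definition ovec W (a : 'rV_(\dim {:W})) : W :=
  vecof (vbasis {:W}) (a *m invmx (onbmx W)).

Lemma ocoK W : cancel (@oco W) (@ovec W).
Proof.
by move=> u; rewrite /ovec ocoE mulmxK ?onbmx_unit // rVofK ?vbasisP.
Qed.

Lemma ovecK W : cancel (@ovec W) (@oco W).
Proof.
by move=> u; rewrite /ovec ocoE vecofK ?vbasisP // mulmxKV ?onbmx_unit.
Qed.

Lemma ovec_is_linear W : linear (@ovec W).
Proof. by move=> a u v; rewrite /ovec mulmxDl -scalemxAl vecof_linear. Qed.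
HB.instance Definition _ W := GRing.isLinear.Build _ _ _ _ (@ovec W) (@ovec_is_linear W).

Lemma oco_is_linear W : linear (@oco W).
Proof. by move=> a u v; rewrite !ocoE rVof_linear mulmxDl -scalemxAl. Qed.
HB.instance Definition _ W := GRing.isLinear.Build _ _ _ _ (@oco W) (@oco_is_linear W).

Lemma oco_inj W : injective (@oco W).
Proof. exact: can_inj (@ocoK W). Qed.

Lemma oco0 W : oco (0 : W) = 0.
Proof. exact: (linear0 (@oco W)). Qed.

Lemma ocoZ W a (u : W) : oco (a *: u) = a *: oco u.
Proof. exact: (linearZ_LR (@oco W)). Qed.

Lemma hs_dot_oco W (u v : W) : hs_dot u v = (oco u *m (oco v)^t*) 0 0.
Proof.
rewrite -[u in LHS](rVofK (vbasisP {:W})).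
rewrite -[v in LHS](rVofK (vbasisP {:W})).
by rewrite hs_dot_gram gram_onbmx !ocoE trmxC_mul !mulmxA.
Qed.

Section Images.
Variables (A : vectType C) (W : hermSpace R).

(** Mixed coordinates: [vbasis] on the source, which carries no inner product here, and orthonormal
    coordinates on the target. The row space describes the image. *)
Definition lmx (f : 'Hom(A, W)) : 'M[C]_(\dim {:A}, \dim {:W}) :=
  locked (mxof (vbasis {:A}) (vbasis {:W}) f *m onbmx W).

Lemma lmxE (f : 'Hom(A, W)) : lmx f = mxof (vbasis {:A}) (vbasis {:W}) f *m onbmx W.
Proof. by rewrite /lmx -lock. Qed.

Lemma oco_app (f : 'Hom(A, W)) u :
  oco (f u) = rVof (vbasis {:A}) u *m lmx f.
Proof. by rewrite ocoE lmxE (rVof_app _ (vbasisP {:A})) mulmxA. Qed.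

Lemma memv_limg (f : 'Hom(A, W)) w : (w \in limg f) = (oco w <= lmx f)%MS.
Proof.
apply/memv_imgP/submxP => [[u _ ->]|[a aE]].
  by exists (rVof (vbasis {:A}) u); rewrite oco_app.
exists (vecof (vbasis {:A}) a); first exact: memvf.
by apply: oco_inj; rewrite oco_app vecofK ?vbasisP.
Qed.

End Images.

Lemma limg_sub (A A' : vectType C) W (f : 'Hom(A, W)) (g : 'Hom(A', W)) :
  (limg f <= limg g)%VS = (lmx f <= lmx g)%MS.
Proof.
apply/subvP/rV_subP => [fg v|fg v].
  by rewrite -{1 2}[v]ovecK -!memv_limg; exact: fg.
by rewrite !memv_limg; exact: fg.
Qed.

(** Its image is the row space of [M], read in orthonormal coordinates; subspaces of [W] are
    presented as such images. *)
Definition rowhom W p (M : 'M[C]_(p, \dim {:W})) : 'Hom('rV[C]_p, W) :=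
  linfun (fun a => ovec (a *m M)).

Lemma rowhomE W p (M : 'M[C]_(p, \dim {:W})) a : rowhom M a = ovec (a *m M).
Proof.
have lin : linear (fun a : 'rV[C]_p => ovec (a *m M)).
  by move=> x u v; rewrite mulmxDl -scalemxAl linearP.
pose L := GRing.isLinear.Build _ _ _ _ _ lin.
pose g : {linear 'rV[C]_p -> W} := HB.pack (fun a : 'rV[C]_p => ovec (a *m M)) L.
exact: (lfunE g a).
Qed.

Lemma memv_rowhom W p (M : 'M[C]_(p, \dim {:W})) w :
  (w \in limg (rowhom M)) = (oco w <= M)%MS.
Proof.
apply/memv_imgP/submxP => [[u _ ->]|[a aE]]; first by exists u; rewrite rowhomE ovecK.
by exists a; rewrite ?memvf // rowhomE -aE ocoK.
Qed.

Lemma eqmx_rowhom W p q (M : 'M[C]_(p, \dim {:W})) (N : 'M[C]_(q, \dim {:W})) :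
  (M :=: N)%MS -> limg (rowhom M) = limg (rowhom N).
Proof. by move=> MN; apply/vspaceP => w; rewrite !memv_rowhom MN. Qed.

Lemma lmx_rowhom W p (M : 'M[C]_(p, \dim {:W})) : (lmx (rowhom M) :=: M)%MS.
Proof.
apply/eqmxP/andP; split; apply/rV_subP => v.
  by rewrite -[v]ovecK -memv_limg memv_rowhom.
by rewrite -[v]ovecK -memv_limg memv_rowhom.
Qed.

Lemma limg_rowhom (A : vectType C) W (f : 'Hom(A, W)) : limg f = limg (rowhom (lmx f)).
Proof. by apply/vspaceP => w; rewrite memv_limg memv_rowhom. Qed.

Lemma dim_rowhom W p (M : 'M[C]_(p, \dim {:W})) : \dim (limg (rowhom M)) = \rank M.
Proof.
rewrite -(eqmx_rowhom (eq_row_base M)) limg_dim_eq.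
  rewrite dimvf dim_matrix; exact: mul1n.
apply/eqP; rewrite capfv -subv0; apply/subvP => a.
rewrite memv_ker rowhomE memv0 => /eqP/(congr1 (@oco W)); rewrite ovecK oco0.
by move=> /eqP; rewrite mulmx_free_eq0 ?row_base_free.
Qed.

Lemma dim_limg (A : vectType C) W (f : 'Hom(A, W)) : \dim (limg f) = \rank (lmx f).
Proof. by rewrite limg_rowhom dim_rowhom. Qed.

Section Nmx.
Variables (U W : hermSpace R).

(** Orthonormal coordinates on both sides. Coordinates are row vectors, so maps act from the right
    and a composition becomes the product in the reverse order. *)
Definition nmx (f : 'Hom(U, W)) : 'M[C]_(\dim {:U}, \dim {:W}) :=
  locked (invmx (onbmx U) *m lmx f).

Definition nhom (M : 'M[C]_(\dim {:U}, \dim {:W})) : 'Hom(U, W) :=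
  hommx (vbasis {:U}) (vbasis {:W}) (onbmx U *m M *m invmx (onbmx W)).

Lemma nmxE (f : 'Hom(U, W)) : nmx f = invmx (onbmx U) *m lmx f.
Proof. by rewrite /nmx -lock. Qed.

Lemma oco_nmx (f : 'Hom(U, W)) u : oco (f u) = oco u *m nmx f.
Proof. by rewrite oco_app nmxE ocoE [RHS]mulmxA mulmxK ?onbmx_unit. Qed.

Lemma mxof_nmx (f : 'Hom(U, W)) :
  mxof (vbasis {:U}) (vbasis {:W}) f = onbmx U *m nmx f *m invmx (onbmx W).
Proof. by rewrite nmxE lmxE mulKVmx ?onbmx_unit // mulmxK ?onbmx_unit. Qed.

Lemma nhomK : cancel nhom nmx.
Proof.
move=> M; rewrite nmxE lmxE /nhom hommxK ?vbasisP // mulmxKV ?onbmx_unit //.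
by rewrite mulKmx ?onbmx_unit.
Qed.

Lemma nmxK : cancel nmx nhom.
Proof. by move=> f; rewrite /nhom -mxof_nmx mxofK ?vbasisP. Qed.

Lemma eqmx_nmx (f : 'Hom(U, W)) : (nmx f :=: lmx f)%MS.
Proof. by rewrite nmxE; apply: eqmxMfull; rewrite row_full_unit unitmx_inv onbmx_unit. Qed.

Lemma nmx_is_linear : linear nmx.
Proof.
move=> a f g; rewrite !nmxE !lmxE mxof_linear mulmxDl mulmxDr.
by rewrite -scalemxAl -scalemxAr.
Qed.
HB.instance Definition _ := GRing.isLinear.Build _ _ _ _ nmx nmx_is_linear.

Lemma nmx_inj : injective nmx.
Proof. exact: can_inj nmxK. Qed.

Lemma nmx0 : nmx 0 = 0.
Proof. exact: (linear0 nmx). Qed.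

Lemma nmxN f : nmx (- f) = - nmx f.
Proof. exact: (linearN nmx). Qed.

Lemma nmxB f g : nmx (f - g) = nmx f - nmx g.
Proof. exact: (linearB nmx). Qed.

Lemma nmxZ a f : nmx (a *: f) = a *: nmx f.
Proof. exact: (linearZ_LR nmx). Qed.

End Nmx.

Lemma nmx_comp (U V W : hermSpace R) (f : 'Hom(U, V)) (g : 'Hom(V, W)) :
  nmx (g \o f)%VF = nmx f *m nmx g.
Proof.
apply/row_matrixP => i; rewrite !rowE; set a := delta_mx _ _.
by rewrite mulmxA -[a]ovecK -!oco_nmx lfunE.
Qed.

Lemma nmx1 W : nmx (\1%VF : 'End(W)) = 1%:M.
Proof.
apply/row_matrixP => i; rewrite !rowE; set a := delta_mx _ _.
by rewrite mulmx1 -[a]ovecK -!oco_nmx lfunE.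
Qed.

Lemma nmx_adj (U W : hermSpace R) (f : 'Hom(U, W)) : nmx (adj f) = (nmx f)^t*.
Proof.
apply/matrixP => j i; rewrite trmxCE.
have dotE (V : hermSpace R) (x : V) (k : 'I_(\dim {:V})) :
    hs_dot x (ovec (delta_mx 0 k)) = oco x 0 k.
  rewrite hs_dot_oco ovecK trmx_delta map_delta_mx -colE [LHS]mxE; exact: erefl.
have := adjP f (ovec (delta_mx 0 i)) (ovec (delta_mx 0 j)).
rewrite (dotE W (f _) j) hs_dotC (dotE U (adj f _) i) !oco_nmx !ovecK -!rowE.
by rewrite ![row _ _ _ _]mxE => ->; rewrite conjCK.
Qed.

Lemma lfun_trace_nmx W (h : 'End(W)) : lfun_trace h = \tr (nmx h).
Proof.
by rewrite /lfun_trace mxof_nmx mxtrace_mulC mulmxA mulVmx ?onbmx_unit // mul1mx.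
Qed.

Lemma lfun_trace0 W : lfun_trace (0 : 'End(W)) = 0.
Proof. by rewrite lfun_trace_nmx nmx0 mxtrace0. Qed.

Lemma lfun_traceN W (h : 'End(W)) : lfun_trace (- h) = - lfun_trace h.
Proof. by rewrite !lfun_trace_nmx nmxN raddfN. Qed.

Lemma adjN U W (h : 'Hom(U, W)) : adj (- h) = - adj h.
Proof. by apply: nmx_inj; rewrite nmxN !nmx_adj nmxN linearN map_mxN. Qed.

End OrthonormalCoordinates.

Section FrameMatrices.
Variables (R : realType) (H : hermSpace R).
Local Notation C := R[i].
Local Notation n := (\dim {:H}).

Lemma mxof_lmx (A : vectType C) (f : 'Hom(A, H)) :
  mxof (vbasis {:A}) (vbasis {:H}) f = lmx f *m invmx (onbmx H).
Proof. by rewrite lmxE mulmxK ?onbmx_unit. Qed.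

(** The left factor accounts for the fact that [vbasis] of the space of row vectors may differ from
    the standard basis. *)
Lemma lmx_rowhomE p (M : 'M[C]_(p, n)) :
  lmx (rowhom M) = (\matrix_a (vbasis {:'rV[C]_p})`_a) *m M.
Proof.
apply/row_matrixP => a; rewrite row_mul rowK.
have := oco_app (rowhom M) (vbasis {:'rV[C]_p})`_a.
by rewrite rVofE ?vbasisP // -rowE rowhomE ovecK.
Qed.

Lemma rowhom_inj p (M : 'M[C]_(p, n)) : row_free M -> injective (rowhom M).
Proof.
move=> Mf a b; rewrite !rowhomE => /(can_inj (@ovecK _ _)).
exact: (row_free_inj Mf).
Qed.

Lemma limg_rowhom_sub p q (M : 'M[C]_(p, n)) (N : 'M[C]_(q, n)) :
  (limg (rowhom M) <= limg (rowhom N))%VS = (M <= N)%MS.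
Proof. by rewrite limg_sub !lmx_rowhom. Qed.

Lemma limg_rowhom_eq p q (M : 'M[C]_(p, n)) (N : 'M[C]_(q, n)) :
  limg (rowhom M) = limg (rowhom N) -> (M :=: N)%MS.
Proof. by move=> MN; apply/eqmxP; rewrite -!limg_rowhom_sub MN subvv. Qed.

End FrameMatrices.

(** * Stability *)

Section Extend.
Variables (m : nat) (T : nat -> Type) (z : forall k, T k).

Lemma extend_ord (x : forall i : 'I_m, T i) (i : 'I_m) : extend z x i = x i.
Proof.
case: i => k km; rewrite /extend; case: {-}_ / idP => // km'.
by rewrite (bool_irrelevance km' km).
Qed.

Lemma extend_ge (x : forall i : 'I_m, T i) k : (m <= k)%N -> extend z x k = z k.
Proof. by rewrite /extend; case: {-}_ / idP => // km; rewrite leqNgt km. Qed.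

Lemma extend_ind (Q : forall k, T k -> Prop) (x : forall i : 'I_m, T i) :
  (forall i : 'I_m, Q i (x i)) -> (forall k, Q k (z k)) -> forall k, Q k (extend z x k).
Proof. by move=> Qx Qz k; rewrite /extend; case: {-}_ / idP => // km; exact: (Qx (Ordinal km)). Qed.

End Extend.

Lemma extend_map m (T S : nat -> Type) (h : forall k, T k -> S k) z (x : forall i : 'I_m, T i) k :
  extend (fun k => h k (z k)) (fun i => h i (x i)) k = h k (extend z x k).
Proof. by rewrite /extend; case: {-}_ / idP. Qed.

Section Stability.
Variables (R : realType) (m : nat) (V : nat -> hermSpace R).
Implicit Types (f : repF m V) (xi : endos m V).

Lemma herm_trace_gt0 (W : hermSpace R) (A : 'End(W)) : adj A = A ->
  (forall (a : R) v, v != 0 -> A v = a%:C *: v -> 0 <= a) ->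
  0 <= lfun_trace A /\ (A != 0 -> 0 < lfun_trace A).
Proof.
move=> Ah Aeig; rewrite lfun_trace_nmx.
have [|a v v0 vA|tr_ge0 tr_gt0] := @hermitian_mxtrace_gt0 R _ (nmx A).
- by rewrite -nmx_adj Ah.
- apply: (Aeig a (ovec v)).
    by apply: contra_neq v0 => /(congr1 (@oco _ _)); rewrite ovecK oco0.
  by apply: oco_inj; rewrite oco_nmx ocoZ !ovecK.
split=> // A0; apply: tr_gt0; apply: contra_neq A0 => /(congr1 (@nhom _ _ _)).
by rewrite nmxK => ->; rewrite -[RHS]nmxK nmx0.
Qed.

Lemma injective_stable (t : 'I_m -> R) f : (forall i, 0 < t i) ->
  (forall i, injective (f i)) -> stable t f.
Proof.
move=> t0 finj xi xiH [i0 xi0] [n [y [w [y0 wE fE]]]].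
pose X k : 'End(V k) := extend (T := fun k => 'End(V k)) (fun k => 0) xi k.
(* Descending induction on [k], starting at [m], where the extension of [xi] is zero: no [X k] has a
   negative eigenvalue. *)
have Xeig k : (k <= m)%N -> forall (a : R) v, v != 0 -> X k v = a%:C *: v -> 0 <= a.
  move=> km; rewrite -(subKn km); elim: (m - k)%N (leq_subr k m) => {k km} [_|k IHk km].
    rewrite subn0 => a v; rewrite /X extend_ge // lfunE /= => v0 /esym/eqP.
    by rewrite scaler_eq0 (negbTE v0) orbF => /eqP/complexI ->.
  have ltm : (m - k.+1 < m)%N by rewrite ltn_subrL; exact: leq_ltn_trans km.
  pose i := Ordinal ltm.
  have IH : forall (a : R) v, v != 0 -> X i.+1 v = a%:C *: v -> 0 <= a.
    by move: (IHk (ltnW km)); rewrite -(subnSK km).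
  rewrite -[(m - k.+1)%N]/(i : nat) => a v v0; rewrite /X extend_ord => xv.
  rewrite leNgt; apply/negP => a0.
  (* A nonzero [w j i v] would be an eigenvector of [X i.+1] for [y j + a], which is negative
     because [y j <= 0] and [a < 0]. *)
  have w0 j : w j i v = 0.
    apply/eqP; apply: contraT => wv0.
    have := congr1 (fun h : 'Hom(V i, V i.+1) => h v) (wE j i).
    rewrite /alpha add_lfunE opp_lfunE !comp_lfunE xv linearZ /= scale_lfunE.
    move=> /eqP; rewrite subr_eq -scalerDl -rmorphD /= => /eqP /(IH _ _ wv0).
    by rewrite leNgt; case/negP; rewrite -[ltRHS]addr0 ler_ltD.
  have : f i v = 0 by rewrite fE sum_lfunE big1.
  by rewrite -[RHS](linear0 (f i)) => /finj v0'; rewrite v0' eqxx in v0.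
have tr i : 0 <= lfun_trace (xi i) /\ (xi i != 0 -> 0 < lfun_trace (xi i)).
  apply: herm_trace_gt0; first exact: xiH.
  by have := Xeig i (ltnW (ltn_ord i)); rewrite /X extend_ord.
rewrite /pairing (bigD1 i0) //= ltr_pwDl //.
  by rewrite mulr_gt0 ?ltcR //; have [_] := tr i0; apply.
by apply: sumr_ge0 => i _; have [ge0 _] := tr i; rewrite mulr_ge0 // ler0c ltW.
Qed.

(* For [z = 0] this is [0], since the inverse of [0] is [0]. *)
Definition lineproj (W : hermSpace R) (z : W) : 'End(W) :=
  nhom (((oco z *m (oco z)^t*) 0 0)^-1 *: ((oco z)^t* *m oco z)).

Lemma nmx_lineproj (W : hermSpace R) (z : W) : nmx (lineproj z) =
  ((oco z *m (oco z)^t*) 0 0)^-1 *: ((oco z)^t* *m oco z).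
Proof. exact: nhomK. Qed.

Lemma lineproj0 (W : hermSpace R) : lineproj (0 : W) = 0.
Proof. by rewrite /lineproj oco0 mulmx0 scaler0 -[RHS]nmxK nmx0. Qed.

Lemma lineproj_idem (W : hermSpace R) (z : W) : (lineproj z \o lineproj z)%VF = lineproj z.
Proof.
apply: nmx_inj; rewrite nmx_comp nmx_lineproj.
have [->|z0] := eqVneq z 0; first by rewrite oco0 mulmx0 scaler0 mulmx0.
set Z := oco z; have : (Z *m Z^t*) 0 0 != 0.
  rewrite gt_eqF // dotmx_gt0 //; apply: contra_neq z0 => /(congr1 (@ovec _ _)).
  by rewrite ocoK linear0.
move: (mx11_scalar (Z *m Z^t*)); move: (_ 0 0) => x ZZ x0.
rewrite -scalemxAl -scalemxAr mulmxA -(mulmxA (Z^t*)) ZZ mul_mx_scalar -scalemxAl.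
by rewrite !scalerA mulVf ?mulr1.
Qed.

Lemma lineproj_adj (W : hermSpace R) (z : W) : adj (lineproj z) = lineproj z.
Proof.
apply: nmx_inj; rewrite nmx_adj nmx_lineproj trmxCZ.
move: (oco z) => Z; rewrite trmxC_mul trmxCK fmorphV /=; congr (_^-1 *: _); apply/CrealP.
by rewrite ger0_real // -dotmxE dnorm_ge0.
Qed.

Lemma lineproj_trace (W : hermSpace R) (z : W) : z != 0 -> lfun_trace (lineproj z) = 1.
Proof.
move=> z0; rewrite lfun_trace_nmx nmx_lineproj mxtraceZ mxtrace_mulC.
rewrite [\tr _]trace_mx11 mulVf //.
by rewrite gt_eqF // dotmx_gt0 //; apply: contra_neq z0 => /(congr1 (@ovec _ _));
  rewrite ocoK linear0.
Qed.

Lemma comp_lineproj (U W : hermSpace R) (g : 'Hom(U, W)) z : g z = 0 ->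
  (g \o lineproj z)%VF = 0.
Proof.
move=> gz; apply: nmx_inj; rewrite nmx_comp nmx_lineproj nmx0.
have zg : oco z *m nmx g = 0 by rewrite -oco_nmx gz oco0.
by rewrite -scalemxAl -[_ *m nmx g]mulmxA zg mulmx0 scaler0.
Qed.

Lemma semistable_injective (t : 'I_m -> R) f : (forall i, 0 < t i) ->
  semistable t f -> forall i, injective (f i).
Proof.
move=> t0 fss i0; apply/lker0P; apply: contraT.
rewrite -subv0 => /subvPn[v]; rewrite memv_ker memv0 => /eqP fv v0.
(* The family is [v] at [i0] and zero elsewhere; thus every [f j] kills [z j], and a single formula
   for [xi] covers all indices. *)
pose z : forall j : 'I_m, V j := @eqtype.dfwith 'I_m (fun j => V j : Type) (fun j => 0) i0 v.
have zi0 : z i0 = v by rewrite /z eqtype.dfwith_in.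
have z0 j : j != i0 -> z j = 0 by move=> ji; rewrite /z eqtype.dfwith_out // eq_sym.
have fz j : f j (z j) = 0.
  by have [->|/z0 ->] := eqVneq j i0; rewrite ?zi0 ?linear0.
pose P k : 'End(V k) :=
  extend (T := fun k => 'End(V k)) (fun k => 0) (fun j => lineproj (z j)) k.
pose xi : endos m V := fun j => - lineproj (z j).
have XE k : extend (T := fun k => 'End(V k)) (fun k => 0) xi k = - P k.
  rewrite -(extend_map (fun k (h : 'End(V k)) => - h) (fun k => 0)).
  by congr (extend _ _ k); apply: functional_extensionality_dep => l; rewrite oppr0.
have PP k : (P k \o P k)%VF = P k.
  apply: (@extend_ind _ (fun k => 'End(V k)) _ (fun k h => (h \o h)%VF = h)) => [i|l].
    exact: lineproj_idem.
  by rewrite comp_lfun0l.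
have tr0 : 0 <= pairing t xi.
  apply: fss => [j||].
  - by rewrite /xi adjN lineproj_adj.
  - exists i0; rewrite oppr_eq0; apply/eqP => P0.
    have := lineproj_trace v0; rewrite -zi0 P0 lfun_trace0 => /esym/eqP.
    by rewrite oner_eq0.
  (* As $f_jP_j=0$, the operator [alpha xi] maps $f_j$ to $-P_{j+1}f_j$. Hence $f=Pf+(f-Pf)$ splits
     [f] into eigenvectors for the eigenvalues $-1$ and $0$. *)
  - pose w0 : repF m V := fun j => (P j.+1 \o f j)%VF.
    exists 2, (fun k => if k == 0 then -1 else 0),
      (fun k => if k == 0 then w0 else fun j => f j - w0 j).
    split=> [k|k j|j]; first by case: ifP => // _; rewrite lerN10.
    + rewrite /alpha XE /xi; case: ifP => _.
        rewrite /w0 comp_lfunA comp_lfunNl PP comp_lfunNr -comp_lfunA.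
        by rewrite comp_lineproj ?fz // comp_lfun0r oppr0 subr0 rmorphN1 scaleN1r comp_lfunNl.
      rewrite scale0r comp_lfunDr comp_lfunNr /w0 comp_lfunA !comp_lfunNl PP subrr.
      rewrite comp_lfunNr comp_lfunDl comp_lfunNl -comp_lfunA comp_lineproj ?fz //.
      by rewrite comp_lfun0r subrr oppr0 subrr.
    + by rewrite big_ord_recl big_ord1 /= addrC subrK.
(* Only [i0] contributes, and the projection onto a line has trace 1: the pairing is [- t i0], which
   is negative. *)
move: tr0; rewrite /pairing (bigD1 i0) //= big1 => [|j ji].
  rewrite addr0 /xi lfun_traceN lineproj_trace ?zi0 //.
  by rewrite mulrN mulr1 oppr_ge0 lecR leNgt t0.
by rewrite /xi z0 // lineproj0 oppr0 lfun_trace0 mulr0.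
Qed.

End Stability.

(** * The zero fibre of the moment map *)

Section PidDiag.
Variable F : fieldType.

Lemma pid_diag p q (s : nat -> F) :
  (pid_mx p : 'M[_]_(p, q)) *m diag_mx (\row_l s l) = diag_mx (\row_l s l) *m pid_mx p.
Proof.
apply/matrixP => i j; rewrite mul_mx_diag mul_diag_mx !mxE mulrC.
by case: eqVneq => [->|_]; rewrite ?mul0r ?mulr0.
Qed.

Lemma pid_diag_pid p q (s : nat -> F) :
  (pid_mx p : 'M[_]_(q, p)) *m diag_mx (\row_l s l) *m (pid_mx p : 'M[_]_(p, q)) =
  diag_mx (\row_l if (l < p)%N then s l else 0).
Proof.
rewrite -mulmxA -pid_diag mulmxA mul_pid_mx !minnn.
apply/matrixP => i j; rewrite mul_mx_diag !mxE.
have [->|ij] := eqVneq i j; first by rewrite eqxx /=; case: ifP; rewrite ?mul1r ?mul0r.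
by rewrite -val_eqE in ij; rewrite (negbTE ij) mul0r mulr0n.
Qed.

End PidDiag.

Section NormalForm.
Variables (R : realType) (m : nat) (V : nat -> hermSpace R) (t : 'I_m -> R).
Hypothesis t_gt0 : forall i, 0 < t i.
Local Notation C := R[i].
Local Notation D k := (\dim {: V k}).
Implicit Types f : repF m V.

Definition amx f k : 'M[C]_(D k, D k.+1) := nmx (arrow f k).

Definition inmx f k : 'M[C]_(D k) :=
  match k return 'M[C]_(D k) with
  | 0 => 0
  | j.+1 => (amx f j)^t* *m amx f j
  end.

Definition wt k : R := extend (T := fun=> R) (fun=> 0) t k.

(** In row coordinates the factors of $f_k^*f_k$ change places. Taking the nonzero factor $i/2$ out
    of [mu] turns $i\,t_k$ into $2t_k$. *)
Lemma mu_eq0P f : (forall i, mu t f i = 0) <->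
  (forall k, (k < m)%N -> amx f k *m (amx f k)^t* = (2 * wt k)%:C%:M + inmx f k).
Proof.
have nin k : nmx (incoming f k) = inmx f k.
  by case: k => [|k] /=; rewrite ?nmx0 // nmx_comp nmx_adj.
have muE (i : 'I_m) : nmx (mu t f i) =
    ('i / 2%:R) *: (amx f i *m (amx f i)^t* - ((2 * wt i)%:C%:M + inmx f i)).
  rewrite /mu nmxB nmxZ nmxB nin nmx_comp nmx_adj nmxZ nmx1.
  rewrite /amx /arrow extend_ord /wt extend_ord opprD addrA.
  rewrite [X in _ = _ *: X]addrAC [RHS]scalerBr; congr (_ - _).
  rewrite -[X in _ = _ *: X]scalemx1 scalerA; congr (_ *: _).
  by rewrite rmorphM rmorph_nat /= mulrA divfK ?pnatr_eq0.
split=> [mu0 k km|F i].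
  have := congr1 (@nmx _ _ _) (mu0 (Ordinal km)); rewrite muE nmx0 => /eqP.
  rewrite scaler_eq0 mulf_eq0 invr_eq0 pnatr_eq0 orbF subr_eq0 /= => /orP[|/eqP //].
  by rewrite eq_complex /= oner_eq0 andbF.
by apply: nmx_inj; rewrite muE (F i (ltn_ord i)) subrr scaler0 nmx0.
Qed.

(* The eigenvalues of [f_k^* f_k] for [f] in the zero fibre: those of
   [f_(k-1) f_(k-1)^*], extended by [0], shifted by [2 t_k]. *)
Fixpoint sg k l : R := 2 * wt k +
  (if k is j.+1 then if (l < D j)%N then sg j l else 0 else 0).

Lemma wt_gt0 k : (k < m)%N -> 0 < wt k.
Proof. by move=> km; rewrite /wt -[k]/(Ordinal km : nat) extend_ord. Qed.

Lemma sg_gt0 k l : (k < m)%N -> 0 < sg k l.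
Proof.
elim: k => [|k IHk] km /=; rewrite ltr_pwDl ?mulr_gt0 ?wt_gt0 //.
by case: ifP => // _; rewrite ltW // IHk // ltnW.
Qed.

Definition sgmx k : 'M[C]_(D k) := diag_mx (\row_l (sg k l)%:C).
Definition sqmx k : 'M[C]_(D k) := diag_mx (\row_l (Num.sqrt (sg k l))%:C).
(** The normal form of [inmx]: the previous eigenvalues on the initial segment of the basis, zero on
    the rest. *)
Definition tailmx k : 'M[C]_(D k) :=
  match k return 'M[C]_(D k) with
  | 0 => 0
  | j.+1 => (pid_mx (D j) : 'M[_]_(D j.+1, D j)) *m sgmx j *m (pid_mx (D j) : 'M[_]_(D j, D j.+1))
  end.
(** The normal form of an arrow, with the square roots of [sg] as singular values. *)
Definition stdmx k : 'M[C]_(D k, D k.+1) := sqmx k *m pid_mx (D k).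

Lemma tailmxE k : tailmx k.+1 = diag_mx (\row_l if (l < D k)%N then (sg k l)%:C else 0).
Proof. exact: (@pid_diag_pid _ _ _ (fun l => (sg k l)%:C)). Qed.

Lemma sgmxE k : sgmx k = (2 * wt k)%:C%:M + tailmx k.
Proof.
case: k => [|k]; first by rewrite addr0; apply/matrixP => a b; rewrite !mxE /= addr0.
rewrite tailmxE; apply/matrixP => a b; rewrite !mxE /=.
by case: eqVneq => _; rewrite ?mulr0n ?addr0 //= rmorphD /=; case: ifP.
Qed.

Lemma sqmx_sq k : (k < m)%N -> sqmx k *m sqmx k = sgmx k.
Proof.
move=> km; rewrite mulmx_diag; congr diag_mx; apply/rowP => l; rewrite !mxE.
by rewrite -rmorphM /= -expr2 sqr_sqrtr // ltW // sg_gt0.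
Qed.

Lemma sqmxC k : (sqmx k)^t* = sqmx k.
Proof.
rewrite tr_diag_mx map_diag_mx; congr diag_mx; apply/rowP => l; rewrite !mxE.
exact: conjc_real.
Qed.

Lemma sqmx_unit k : (k < m)%N -> sqmx k \in unitmx.
Proof.
move=> km; rewrite unitmxE det_diag unitfE; apply/prodf_neq0 => l _.
rewrite mxE -[X in _ != X](rmorph0 (real_complex R)) (inj_eq (@complexI _)).
by rewrite gt_eqF // sqrtr_gt0 sg_gt0.
Qed.

Lemma stdmx_trC k : (k < m)%N -> (D k <= D k.+1)%N ->
  stdmx k *m (stdmx k)^t* = sgmx k.
Proof.
move=> km Dk; rewrite /stdmx trmxC_mul trmxC_pid sqmxC mulmxA -(mulmxA (sqmx k)).
by rewrite mul_pid_mx minnn (minn_idPr Dk) pid_mx_1 mulmx1 sqmx_sq.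
Qed.

Lemma trC_stdmx k : (k < m)%N -> (stdmx k)^t* *m stdmx k = tailmx k.+1.
Proof.
move=> km; rewrite /stdmx trmxC_mul trmxC_pid sqmxC /= -(sqmx_sq km).
by rewrite !mulmxA.
Qed.

(** By the moment map equation the rows of [E *m amx f k] are orthogonal with squared lengths
    [sg k l]. Normalized, they form an orthonormal family of [D k] vectors in a space of dimension
    [D k.+1], whence the inequality, and a completion of this family to an orthonormal basis is the
    required [E']. *)
Lemma normal_form_step f k (E : 'M[C]_(D k)) : (k < m)%N ->
  (forall k, (k < m)%N -> amx f k *m (amx f k)^t* = (2 * wt k)%:C%:M + inmx f k) ->
  E \is unitarymx -> E *m inmx f k *m E^t* = tailmx k ->
  (D k <= D k.+1)%N /\
  exists2 E' : 'M[C]_(D k.+1), E' \is unitarymx /\ E' *m inmx f k.+1 *m E'^t* = tailmx k.+1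
    & E *m amx f k = stdmx k *m E'.
Proof.
move=> km muf Eu Ein; have Lu := sqmx_unit km.
have EE : E *m E^t* = 1%:M by exact/unitarymxP.
pose A := invmx (sqmx k) *m E *m amx f k.
have EFE : E *m amx f k *m (amx f k)^t* *m E^t* = sqmx k *m sqmx k.
  rewrite -(mulmxA E) (muf k km) mulmxDr mulmxDl Ein mul_mx_scalar -scalemxAl EE scalemx1.
  by rewrite sqmx_sq // sgmxE.
have Au : A \is unitarymx.
  apply/unitarymxP; rewrite /A !trmxC_mul trmxC_inv sqmxC.
  have -> : invmx (sqmx k) *m E *m amx f k *m ((amx f k)^t* *m (E^t* *m invmx (sqmx k)))
      = invmx (sqmx k) *m (E *m amx f k *m (amx f k)^t* *m E^t*) *m invmx (sqmx k).
    by rewrite !mulmxA.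
  by rewrite EFE mulKmx // mulmxV.
have Df : (D k <= D k.+1)%N by rewrite -(mxrank_unitary Au) rank_leq_col.
split=> //.
have [Y Yu YA] := row_free_complete (introT eqP (mxrank_unitary Au)).
have EkA : E *m amx f k = stdmx k *m gs Y.
  by rewrite /stdmx -[RHS]mulmxA gs_id ?YA // /A -!mulmxA mulKVmx.
exists (gs Y) => //; split; first exact: gs_unitary.
have -> : inmx f k.+1 = (E *m amx f k)^t* *m (E *m amx f k).
  by rewrite trmxC_mul -mulmxA (mulmxA (E^t*)) (mulmx1C EE) mul1mx.
have QQ := unitarymxP (gs_unitary Yu); rewrite EkA; have := trC_stdmx km; move: (gs Y) (stdmx k) QQ => Q S QQ <-.
by rewrite trmxC_mul !mulmxA QQ mul1mx -mulmxA QQ mulmx1.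
Qed.

End NormalForm.

Section CompArrows.
Variables (R : realType) (m : nat) (V : nat -> hermSpace R) (f : repF m V).

Lemma comp_arrows_id i : comp_arrows f i i = \1%VF.
Proof.
case: i => [|i] /=; case: {-}_ / eqP => // e; by rewrite (eq_axiomK e).
Qed.

Lemma comp_arrowsS i j : (i <= j)%N ->
  comp_arrows f i j.+1 = (arrow f j \o comp_arrows f i j)%VF.
Proof.
move=> ij; rewrite {1}/comp_arrows; case: {-}_ / eqP => // e.
by exfalso; have := ij; rewrite e ltnn.
Qed.

End CompArrows.

(** * Orthonormal frames for points of the zero fibre, and their flags *)

Section MomentFibre.
Variables (R : realType) (m : nat) (V : nat -> hermSpace R) (t : 'I_m -> R).
Hypothesis t_gt0 : forall i, 0 < t i.
Local Notation C := R[i].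
Local Notation D k := (\dim {: V k}).
Implicit Types f : repF m V.

(* The rows of [E k] are an orthonormal basis of [V k] in which [f] takes its
   normal form. *)
Definition framed f (E : forall k, 'M[C]_(D k)) :=
  (forall k, (k <= m)%N -> E k \is unitarymx) /\
  (forall k, (k < m)%N -> (D k <= D k.+1)%N /\ E k *m amx f k = stdmx V t k *m E k.+1).

Lemma normal_form f : (forall i, mu t f i = 0) -> exists E, framed f E.
Proof.
move=> /mu_eq0P muf.
pose P k (E : 'M[C]_(D k)) := E \is unitarymx /\ E *m inmx f k *m E^t* = tailmx V t k.
(* The conditions on [k] and [E] are premises inside the property, with witness 0 if they fail. The
   choice is therefore a total function, which [nat_rect] can iterate. *)
have step k (E : 'M[C]_(D k)) : {E' : 'M[C]_(D k.+1) |
    (k < m)%N -> P k E -> [/\ (D k <= D k.+1)%N, P k.+1 E' & E *m amx f k = stdmx V t k *m E']}.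
  apply: cid; have [km|] := ltnP k m; last by exists 0.
  have [PE|] := pselect (P k E); last by exists 0.
  have [Eu Ein] := PE.
  have [Dk [E' PE' EE']] := normal_form_step t_gt0 km muf Eu Ein.
  by exists E'.
pose E := nat_rect (fun k => 'M[C]_(D k)) 1%:M (fun k Ek => projT1 (step k Ek)).
have EP k : (k <= m)%N -> P k (E k).
  elim: k => [_|k IHk km].
    split; last by rewrite mulmx0 mul0mx.
    by apply/unitarymxP; rewrite mul1mx trmx1 map_mx1.
  by rewrite /E /=; case: (step _ _) => E' /= /(_ km (IHk (ltnW km))) [].
exists E; split=> [k /EP[] //|k km].
rewrite [E k.+1]/=; case: (step _ _) => E' /= /(_ km (EP k (ltnW km))) [Dk _ EE'].
by [].
Qed.

(** Converse of [normal_form]: it puts the arrows built from prescribed unitary matrices into the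
    zero fibre, which yields the sections of the charts. *)
Lemma framed_mu f E : framed f E -> forall i, mu t f i = 0.
Proof.
move=> [Eu EF]; apply/mu_eq0P => k km.
have FE j : (j < m)%N -> amx f j = (E j)^t* *m stdmx V t j *m E j.+1.
  move=> jm; have [_ EFj] := EF j jm; rewrite -mulmxA -EFj mulmxA.
  by rewrite (mulmx1C (unitarymxP (Eu j (ltnW jm)))) mul1mx.
have tailE : inmx f k = (E k)^t* *m tailmx V t k *m E k.
  case: k km => [|k] km; first by rewrite /= mulmx0 mul0mx.
  rewrite /inmx -(trC_stdmx V t_gt0 (ltnW km)) FE ?(ltnW km) //.
  have := unitarymxP (Eu k (ltnW (ltnW km))).
  move: (E k) (E k.+1) (stdmx V t k) => A B S AA.
  by rewrite !trmxC_mul trmxCK !mulmxA -(mulmxA _ A) AA mulmx1.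
have [Dk _] := EF k km.
rewrite tailE FE //.
have := unitarymxP (Eu _ km); have := unitarymxP (Eu _ (ltnW km)).
have := stdmx_trC t_gt0 km Dk; rewrite sgmxE.
move: (E k) (E k.+1) (stdmx V t k) => A B S SS AA BB.
rewrite !trmxC_mul trmxCK -!mulmxA (mulmxA B) BB mul1mx.
rewrite (mulmxA S) SS mulmxDl mulmxDr.
by rewrite mul_scalar_mx -scalemxAr (mulmx1C AA) scalemx1.
Qed.

Lemma framed_dim f E i j : framed f E -> (i <= j)%N -> (j <= m)%N -> (D i <= D j)%N.
Proof.
move=> [_ EF]; elim: j => [|j IHj]; first by rewrite leqn0 => /eqP ->.
rewrite leq_eqVlt => /orP[/eqP -> //|ij] jm.
by apply: leq_trans (IHj ij (ltnW jm)) _; have [] := EF j jm.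
Qed.

Lemma framed_comp f E i j : framed f E -> (i <= j)%N -> (j <= m)%N ->
  exists2 nu : 'M[C]_(D i), nu \in unitmx &
    E i *m nmx (comp_arrows f i j) = nu *m ((pid_mx (D i) : 'M[_]_(D i, D j)) *m E j).
Proof.
(* The left factor is in fact diagonal. At each further arrow its entries are multiplied by singular
   values, since the diagonal part of [stdmx] moves to the left past [pid_mx] by [pid_diag]. *)
move=> fE ij jm; suff [nu nu0 nuE] : exists2 nu : nat -> C, (forall l, nu l != 0) &
    E i *m nmx (comp_arrows f i j) =
    diag_mx (\row_l nu l) *m ((pid_mx (D i) : 'M[_]_(D i, D j)) *m E j).
  exists (diag_mx (\row_l nu l)) => //.
  by rewrite unitmxE det_diag unitfE; apply/prodf_neq0 => l _; rewrite mxE.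
have id_case k : exists2 nu : nat -> C, (forall l, nu l != 0) &
    E k *m nmx (comp_arrows f k k) =
    diag_mx (\row_l nu l) *m ((pid_mx (D k) : 'M[_]_(D k, D k)) *m E k).
  exists (fun=> 1) => [l|]; first exact: oner_neq0.
  rewrite comp_arrows_id nmx1 mulmx1 pid_mx_1 mul1mx.
  by rewrite (_ : \row_l 1 = const_mx 1) ?diag_const_mx ?mul1mx //; apply/rowP => l; rewrite !mxE.
elim: j ij jm => [|j IHj] ij jm.
  by move: ij; rewrite leqn0 => /eqP ->; exact: id_case.
move: ij; rewrite leq_eqVlt => /orP[/eqP ->|ij]; first exact: id_case.
have [nu nu0 nuE] := IHj ij (ltnW jm).
exists (fun l => nu l * (Num.sqrt (sg V t j l))%:C) => [l|].
  rewrite mulf_neq0 //; apply/eqP => /complexI/eqP; apply/negP.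
  by rewrite gt_eqF // sqrtr_gt0 sg_gt0.
have [Dj EEj] := fE.2 j jm.
rewrite comp_arrowsS // nmx_comp mulmxA nuE -!mulmxA EEj /stdmx /sqmx -mulmxA.
rewrite (mulmxA (pid_mx _) (diag_mx _)) (@pid_diag _ _ _ (fun l => (Num.sqrt (sg V t j l))%:C)).
rewrite -mulmxA pid_mxM ?(framed_dim fE) ?(ltnW jm) //.
rewrite mulmxA mulmx_diag; congr (diag_mx _ *m _).
by apply/rowP => l; rewrite !mxE.
Qed.

Lemma flag_framed f E (i : 'I_m) : framed f E ->
  flag_of f i = limg (rowhom ((pid_mx (D i) : 'M[_]_(D i, D m)) *m E m)).
Proof.
move=> fE; have [nu nuu nuE] := framed_comp fE (ltnW (ltn_ord i)) (leqnn m).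
have Eiu := unitarymx_unit (fE.1 i (ltnW (ltn_ord i))).
rewrite /flag_of limg_rowhom; apply: eqmx_rowhom.
apply: eqmx_trans (eqmx_sym (eqmx_nmx _)) _.
have full p (A : 'M[C]_p) q (B : 'M[C]_(p, q)) : A \in unitmx -> (A *m B :=: B)%MS.
  by move=> Au; apply: eqmxMfull; rewrite row_full_unit.
apply: eqmx_trans (eqmx_sym (full _ _ _ _ Eiu)) _; rewrite nuE; exact: full.
Qed.

End MomentFibre.

(** * The unitary action and its orbits *)

Section Orbits.
Variables (R : realType) (m : nat) (V : nat -> hermSpace R).
Local Notation C := R[i].
Local Notation D k := (\dim {: V k}).
Implicit Types (f : repF m V) (g : endos m V).

Definition gext g k : 'End(V k) := extend (T := fun k => 'End(V k)) (fun k => \1%VF) g k.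

Lemma gext_ord g (i : 'I_m) : gext g i = g i.
Proof. exact: extend_ord. Qed.

Lemma gext_m g : gext g m = \1%VF.
Proof. exact: extend_ge. Qed.

(** For unitary [g] this is [act g f = f'], written without inverses. *)
Definition intertwines g f f' := forall i : 'I_m, (gext g i.+1 \o f i = f' i \o g i)%VF.

Lemma unitary_lker g (i : 'I_m) : unitary g -> lker (g i) == 0%VS.
Proof.
move=> gu; apply/lker0P => u v guv; apply/eqP; rewrite -subr_eq0 -(dnorm_eq0 hs_dot).
by rewrite -(gu i) linearB /= guv subrr linear0l.
Qed.

Lemma unitary_nmx g : unitary g <-> forall i : 'I_m, nmx (g i) \is unitarymx.
Proof.
have gE (i : 'I_m) u v : hs_dot (g i u) (g i v) =
    (oco u *m (nmx (g i) *m (nmx (g i))^t*) *m (oco v)^t*) 0 0.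
  rewrite hs_dot_oco !oco_nmx; move: (oco u) (oco v) (nmx (g i)) => a b G.
  by rewrite trmxC_mul !mulmxA.
split=> gu i; last by move=> u v; rewrite gE (unitarymxP (gu i)) mulmx1 hs_dot_oco.
have dE (M : 'M[C]_(D i)) a b : M a b =
    ((delta_mx 0 a : 'rV[C]_(D i)) *m M *m (delta_mx 0 b : 'rV[C]_(D i))^t*) 0 0.
  by rewrite trmx_delta map_delta_mx -rowE -colE [RHS]mxE [RHS]mxE.
apply/unitarymxP/matrixP => a b; rewrite dE [RHS]dE mulmx1.
have := gu i (ovec (delta_mx 0 a)) (ovec (delta_mx 0 b)).
rewrite gE (hs_dot_oco (ovec (delta_mx 0 a)) (ovec (delta_mx 0 b))).
by rewrite (@ovecK _ (V i) (delta_mx 0 a)) (@ovecK _ (V i) (delta_mx 0 b)).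
Qed.

Lemma act_intertwines g f f' : unitary g -> (act g f = f' <-> intertwines g f f').
Proof.
move=> gu; split=> [<- i|gff'].
  by rewrite /act -/(gext g i.+1) lker0_compfVK ?unitary_lker.
apply: functional_extensionality_dep => i.
by rewrite /act -/(gext g i.+1) gff' lker0_compfK ?unitary_lker.
Qed.

Lemma unitary_comp g g' : unitary g -> unitary g' -> unitary (fun i => (g' i \o g i)%VF).
Proof. by move=> gu gu' i u v; rewrite !comp_lfunE gu' gu. Qed.

Lemma unitary_inv g : unitary g -> unitary (fun i => (g i)^-1%VF).
Proof.
move=> gu i u v; rewrite -gu -!comp_lfunE.
by rewrite lker0_compfV ?unitary_lker // !id_lfunE.
Qed.

Lemma gext_comp g g' k : (k <= m)%N ->
  gext (fun i => (g' i \o g i)%VF) k = (gext g' k \o gext g k)%VF.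
Proof.
rewrite leq_eqVlt => /orP[/eqP ->|km]; first by rewrite !gext_m comp_lfun1l.
by rewrite -[k]/(Ordinal km : nat) !gext_ord.
Qed.

Lemma intertwines_comp g g' f f' f'' :
  intertwines g f f' -> intertwines g' f' f'' -> intertwines (fun i => (g' i \o g i)%VF) f f''.
Proof.
move=> gf gf' i; rewrite gext_comp // -comp_lfunA gf comp_lfunA gf'.
by rewrite comp_lfunA.
Qed.

Lemma intertwines_inv g f f' : unitary g ->
  intertwines g f f' -> intertwines (fun i => (g i)^-1%VF) f' f.
Proof.
move=> gu gf i.
have gK k : (k <= m)%N -> (gext (fun i => (g i)^-1) k \o gext g k)%VF = \1%VF.
  rewrite leq_eqVlt => /orP[/eqP ->|km]; first by rewrite !gext_m comp_lfun1l.
  by rewrite -[k]/(Ordinal km : nat) !gext_ord lker0_compVf ?unitary_lker.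
have := congr1 (fun h => gext (fun i => (g i)^-1%VF) i.+1 \o h \o (g i)^-1)%VF (gf i).
rewrite !comp_lfunA gK // comp_lfun1l => ->.
by rewrite lker0_compfK ?unitary_lker.
Qed.

Lemma orbit_intertwines g f f' : unitary g -> intertwines g f f' -> orbit f = orbit f'.
Proof.
suff sub g0 f0 f1 : unitary g0 -> intertwines g0 f0 f1 -> orbit f1 `<=` orbit f0.
  move=> gu gf; apply/seteqP; split; last exact: sub gf.
  by apply: (sub _ _ _ (unitary_inv gu)); exact: intertwines_inv.
move=> gu gf _ [g1 g1u <-]; exists (fun i => (g1 i \o g0 i)%VF); first exact: unitary_comp.
apply/act_intertwines; first exact: unitary_comp.
by apply: (intertwines_comp gf); apply/act_intertwines.
Qed.

Lemma orbit_refl f : orbit f f.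
Proof.
have u1 : unitary (fun i : 'I_m => \1%VF : 'End(V i)) by move=> i u v; rewrite !id_lfunE.
exists (fun i => \1%VF) => //; apply/act_intertwines => // i.
rewrite comp_lfun1r (_ : gext _ _ = \1%VF) ?comp_lfun1l //.
have := ltn_ord i; rewrite leq_eqVlt => /orP[/eqP ->|im]; first by rewrite gext_m.
by rewrite -[i.+1]/(Ordinal im : nat) gext_ord.
Qed.

(** Along a composition of arrows the intermediate factors of [g] cancel. What remains is the
    identity on [V m] and the bijection [g i] at the source, and neither changes the image. *)
Lemma flag_orbit f f' : orbit f f' -> flag_of f' = flag_of f.
Proof.
move=> [g gu /(act_intertwines _ _ gu) gf]; apply: functional_extensionality_dep => i.
have comm j : (i <= j)%N -> (j <= m)%N ->
    (comp_arrows f' i j \o gext g i = gext g j \o comp_arrows f i j)%VF.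
  elim: j => [|j IHj].
    by rewrite leqn0 => /eqP -> _; rewrite !comp_arrows_id comp_lfun1l comp_lfun1r.
  rewrite leq_eqVlt => /orP[/eqP -> _|ij jm].
    by rewrite !comp_arrows_id comp_lfun1l comp_lfun1r.
  rewrite !comp_arrowsS // -comp_lfunA IHj ?(ltnW jm) // !comp_lfunA; congr (_ \o _)%VF.
  rewrite -[j]/(Ordinal jm : nat) /arrow !extend_ord gext_ord.
  by rewrite -gf.
have := comm m (ltnW (ltn_ord i)) (leqnn m); rewrite gext_m comp_lfun1l gext_ord.
rewrite /flag_of => <-; rewrite limg_comp; congr (_ @: _)%VS.
by apply/esym/lker0_limgf/unitary_lker.
Qed.

End Orbits.

(** * The flag determines the orbit *)

Section BlockUnitary.
Variables (R : realType).
Local Notation C := R[i].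

(** If $PQ=XPQ'$, where [P] keeps the first [p] rows, then $PQQ'^*=XP$, whose columns from [p] on
    vanish. With [Q] and [Q'] exchanged, the same statement treats the other off-diagonal block. *)
Lemma block_unitary n p (Q Q' : 'M[C]_n) : (p <= n)%N ->
  Q \is unitarymx -> Q' \is unitarymx ->
  ((pid_mx p : 'M[_]_(p, n)) *m Q <= (pid_mx p : 'M[_]_(p, n)) *m Q')%MS ->
  (pid_mx p : 'M[_]_(p, n)) *m (Q *m Q'^t*) =
  (pid_mx p : 'M[_]_(p, n)) *m (Q *m Q'^t*) *m (pid_mx p : 'M[_]_(n, p)) *m (pid_mx p : 'M[_]_(p, n)).
Proof.
move=> pn /unitarymxP QQ /unitarymxP QQ' /submxP[X XE].
have -> : (pid_mx p : 'M[_]_(p, n)) *m (Q *m Q'^t*) = X *m (pid_mx p : 'M[_]_(p, n)).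
  by rewrite mulmxA XE -!mulmxA QQ' mulmx1.
by rewrite -!mulmxA !mul_pid_mx !minnn (minn_idPr pn).
Qed.

(** Entry by entry: wherever [A a b] is nonzero the diagonal entries at [a] and [b] agree, and so do
    their square roots. *)
Lemma diag_sqrt_comm n (s : nat -> R) (A : 'M[C]_n) : (forall l, (l < n)%N -> 0 < s l) ->
  diag_mx (\row_l (s l)%:C) *m A = A *m diag_mx (\row_l (s l)%:C) ->
  diag_mx (\row_l (Num.sqrt (s l))%:C) *m A = A *m diag_mx (\row_l (Num.sqrt (s l))%:C).
Proof.
move=> s0 /matrixP sA; apply/matrixP => a b; have := sA a b.
rewrite !mul_diag_mx !mul_mx_diag !mxE mulrC => sab.
have [->|A0] := eqVneq (A a b) 0; first by rewrite mulr0 mul0r.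
by move/(mulfI A0)/complexI: sab => ->; rewrite mulrC.
Qed.

End BlockUnitary.

Section OrbitUniqueness.
Variables (R : realType) (m : nat) (V : nat -> hermSpace R) (t : 'I_m -> R).
Hypothesis t_gt0 : forall i, 0 < t i.
Local Notation C := R[i].
Local Notation D k := (\dim {: V k}).

Lemma flag_of_inj (f f' : repF m V) : (forall i, mu t f i = 0) -> (forall i, mu t f' i = 0) ->
  flag_of f = flag_of f' -> orbit f = orbit f'.
Proof.
move=> /(normal_form t_gt0)[E fE] /(normal_form t_gt0)[E' fE'] ff'.
pose n := D m; pose P k : 'M[C]_(D k, n) := pid_mx (D k).
pose P' k : 'M[C]_(n, D k) := pid_mx (D k).
have Dm k : (k <= m)%N -> (D k <= n)%N by move=> km; exact: framed_dim fE km _.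
have Emu := unitarymxP (fE.1 m (leqnn m)); have Emu' := unitarymxP (fE'.1 m (leqnn m)).
have PE k : (k <= m)%N -> (P k *m E m :=: P k *m E' m)%MS.
  rewrite leq_eqVlt => /orP[/eqP ->|km].
    rewrite /P !pid_mx_1 !mul1mx; apply/eqmxP.
    by rewrite !submx_full // row_full_unit unitarymx_unit ?fE.1 ?fE'.1.
  pose i := Ordinal km; have := congr1 (fun F => F i) ff'.
  rewrite (flag_framed t_gt0 i fE) (flag_framed t_gt0 i fE') => EE'.
  exact: limg_rowhom_eq EE'.
(* [W] compares the two orthonormal bases of the last space. As the flags coincide, it is block
   diagonal, and its upper left corners [w k] of size [D k] are unitary. *)
have [W WE] : exists W, W = E m *m (E' m)^t* by exists (E m *m (E' m)^t*).
have WC : W^t* = E' m *m (E m)^t* by rewrite WE trmxC_mul trmxCK.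
pose w k := P k *m W *m P' k.
have Pw k : (k <= m)%N -> P k *m W = w k *m P k.
  by move=> km; rewrite /w WE -block_unitary ?fE.1 ?fE'.1 ?Dm // PE.
have PwC k : (k <= m)%N -> P k *m W^t* = (w k)^t* *m P k.
  move=> km; rewrite /w !trmxC_mul !trmxC_pid WC mulmxA.
  by rewrite -block_unitary ?fE.1 ?fE'.1 ?Dm // PE.
have wP k : (k <= m)%N -> W *m P' k = P' k *m w k.
  move=> km; have := congr1 (fun A => A^t*) (PwC k km).
  by rewrite !trmxC_mul !trmxCK !trmxC_pid.
have WW : W *m W^t* = 1%:M.
  by rewrite WC WE -!mulmxA (mulmxA _ (E' m)) (mulmx1C Emu') mul1mx.
have wu k : (k <= m)%N -> w k \is unitarymx.
  move=> km; apply/unitarymxP.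
  have -> : (w k)^t* = P k *m W^t* *m P' k by rewrite /w !trmxC_mul !trmxC_pid mulmxA.
  rewrite mulmxA mulmxA -Pw // -(mulmxA _ W) WW mulmx1.
  by rewrite mul_pid_mx minnn (minn_idPr (Dm k km)) pid_mx_1.
pose J k : 'M[C]_(D k, D k.+1) := pid_mx (D k).
pose J' k : 'M[C]_(D k.+1, D k) := pid_mx (D k).
have Dk k : (k < m)%N -> (D k <= D k.+1)%N by move=> km; have [] := fE.2 k km.
have JP k : (k < m)%N -> J k *m P k.+1 = P k.
  move=> km; rewrite /J /P mul_pid_mx; congr pid_mx.
  by rewrite (minn_idPl (Dk k km)) (minn_idPr (Dk k km)).
have PJ k : (k < m)%N -> P' k.+1 *m J' k = P' k.
  move=> km; rewrite /J' /P' mul_pid_mx; congr pid_mx.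
  by rewrite (minn_idPr (Dk k km)) (minn_idPr (Dk k km)).
have PP k : (k < m)%N -> P k *m P' k.+1 = J k.
  move=> km; rewrite /J /P /P' mul_pid_mx; congr pid_mx.
  by rewrite (minn_idPl (Dk k km)) (minn_idPr (Dm k (ltnW km))).
have PP' k : (k < m)%N -> P k.+1 *m P' k = J' k.
  move=> km; rewrite /J' /P /P' mul_pid_mx; congr pid_mx.
  by rewrite (minn_idPr (Dk k km)) (minn_idPr (Dm k (ltnW km))).
have Jw k : (k < m)%N -> J k *m w k.+1 = w k *m J k.
  by move=> km; rewrite {1}/w !mulmxA JP // Pw ?(ltnW km) // -mulmxA PP.
have wJ k : (k < m)%N -> w k.+1 *m J' k = J' k *m w k.
  move=> km; rewrite {1}/w -!mulmxA PJ // wP ?(ltnW km) //.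
  by rewrite mulmxA PP'.
have wm : w m = W by rewrite /w /P /P' !pid_mx_1 mul1mx mulmx1.
clearbody w.
(* By [sgmxE], [sgmx k] is a scalar matrix plus the previous [sgmx] extended by zero, and [w k] is
   compatible with the inclusion of the previous corner; so commutation passes from one index to the
   next. *)
have sgw k : (k < m)%N -> sgmx V t k *m w k = w k *m sgmx V t k.
  elim: k => [|k IHk] km; rewrite sgmxE mulmxDl mulmxDr scalar_mxC; congr (_ + _).
    by rewrite mul0mx mulmx0.
  rewrite /tailmx -/(J k) -/(J' k) -!mulmxA Jw ?(ltnW km) //.
  by rewrite (mulmxA (sgmx _ _ _)) IHk ?(ltnW km) // !mulmxA wJ ?(ltnW km).
have sqw k : (k < m)%N -> sqmx V t k *m w k = w k *m sqmx V t k.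
  move=> km; apply: (@diag_sqrt_comm _ _ (sg V t k)); last exact: sgw.
  by move=> l _; exact: sg_gt0.
(* The element of $K$ that carries [f] to [f']. For [k = m] the same formula gives the identity, in
   agreement with the convention in [gext]. *)
pose g : endos m V := fun i => nhom ((E i)^t* *m w i *m E' i).
have EE k : (k <= m)%N -> E k *m (E k)^t* = 1%:M /\ E' k *m (E' k)^t* = 1%:M.
  by move=> km; rewrite !(unitarymxP _) ?fE.1 ?fE'.1.
have gE k : (k <= m)%N -> nmx (gext g k) = (E k)^t* *m w k *m E' k.
  rewrite leq_eqVlt => /orP[/eqP ->|km]; last first.
    by rewrite -[k]/(Ordinal km : nat) gext_ord nhomK.
  rewrite gext_m nmx1 wm WE.
  by rewrite !mulmxA (mulmx1C Emu) mul1mx (mulmx1C Emu').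
have gu : unitary g.
  apply/unitary_nmx => i; apply/unitarymxP; rewrite nhomK.
  have im := ltnW (ltn_ord i); have [E1 E2] := EE i im.
  rewrite !trmxC_mul trmxCK !mulmxA -(mulmxA _ (E' i)) E2 mulmx1.
  by rewrite -(mulmxA _ (w i)) (unitarymxP (wu i im)) mulmx1 (mulmx1C E1).
apply: (orbit_intertwines gu) => i; apply: nmx_inj.
have im := ltn_ord i; have [E1 E2] := EE i (ltnW im).
have aE (h : repF m V) (F : forall k, 'M[C]_(D k)) : framed t h F ->
    amx h i = (F i)^t* *m stdmx V t i *m F i.+1.
  move=> [Fu FF]; have [_ FFi] := FF i im; rewrite -mulmxA -FFi mulmxA.
  by rewrite (mulmx1C (unitarymxP (Fu i (ltnW im)))) mul1mx.
rewrite !nmx_comp -[g i]gext_ord !gE ?(ltnW im) //.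
have -> : nmx (f i) = amx f i by rewrite /amx /arrow extend_ord.
have -> : nmx (f' i) = amx f' i by rewrite /amx /arrow extend_ord.
rewrite (aE _ _ fE) (aE _ _ fE').
have sw : stdmx V t i *m w i.+1 = w i *m stdmx V t i.
  by rewrite /stdmx -mulmxA Jw // mulmxA sqw // mulmxA.
have [E3 _] := EE i.+1 im.
move: (stdmx V t i) (w i) (w i.+1) sw => S w0 w1 sw.
rewrite -!mulmxA; congr (_ *m _); rewrite !mulmxA -(mulmxA S) E3 mulmx1.
by rewrite -(mulmxA w0) E2 mulmx1 sw.
Qed.

End OrbitUniqueness.

(** * Charts *)

Lemma mulmx_pidE (F : fieldType) q n p (A : 'M[F]_(q, n)) k (l : 'I_p) (l' : 'I_n) :
  (l' : nat) = l -> (A *m (pid_mx p : 'M[_]_(n, p))) k l = A k l'.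
Proof.
move=> ll; rewrite mxE (bigD1 l') //= big1 => [|j jl]; first by rewrite mxE ll eqxx ltn_ord mulr1 addr0.
rewrite mxE; case: eqVneq => [jl'|]; last by rewrite mulr0.
by case/eqP: jl; apply: val_inj; rewrite /= ll.
Qed.

(** * Unipotent coordinates of flags near a given one *)

Section FlagCoordinates.
Variables (R : realType) (m n : nat) (d : 'I_m -> nat).
Hypothesis d_mono : forall i j : 'I_m, (i <= j)%N -> (d i <= d j)%N.
Hypothesis d_le : forall i, (d i <= n)%N.
Local Notation C := R[i].

(* The positions strictly above the diagonal blocks for the block ends [d j]. *)
Definition flag_pos (k l : 'I_n) := [exists j : 'I_m, (k < d j <= l)%N].

(** The boolean separates the real part ([true]) from the imaginary part. *)
Definition flag_index := {x : 'I_n * 'I_n * bool | flag_pos x.1.1 x.1.2}.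
Local Notation K := #|{: flag_index}|.

Definition flag_coef (x : 'rV[R]_K) (k l : 'I_n) (b : bool) : R :=
  if insub (k, l, b) is Some s then x 0 (enum_rank (s : flag_index)) else 0.

Definition flag_mx (x : 'rV[R]_K) : 'M[C]_n :=
  \matrix_(k, l) ((k == l)%:R + (flag_coef x k l true +i* flag_coef x k l false)).

Definition flag_crd (M : 'M[C]_n) : 'rV[R]_K :=
  \row_a let: (k, l, b) := val (enum_val a : flag_index) in
         if b then complex.Re (M k l) else complex.Im (M k l).

Definition flag_unip (M : 'M[C]_n) := forall k l, ~~ flag_pos k l -> M k l = (k == l)%:R.

Lemma flag_pos_lt k l : flag_pos k l -> (k < l)%N.
Proof. by case/existsP => j /andP[]; exact: leq_trans. Qed.

Lemma flag_mx_unip x : flag_unip (flag_mx x).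
Proof.
move=> k l nkl; rewrite mxE /flag_coef !insubN //.
by rewrite -[X in _ + X]/(0 : C) addr0.
Qed.

Lemma flag_mxK : cancel flag_mx flag_crd.
Proof.
move=> x; apply/rowP => a; rewrite mxE.
have aE := enum_valK a; move: (enum_val a) aE => [[[k l] b] s] aE /=.
have kl : (k == l) = false by apply/negbTE; rewrite -val_eqE neq_ltn (flag_pos_lt s).
rewrite mxE kl add0r /flag_coef !insubT /= -aE.
by case: b s aE => s aE; congr (x 0 (enum_rank _)); exact: val_inj.
Qed.

Lemma flag_crdK M : flag_unip M -> flag_mx (flag_crd M) = M.
Proof.
move=> Mu; apply/matrixP => k l; case kl : (flag_pos k l); last first.
  by rewrite flag_mx_unip ?kl // Mu ?kl.
rewrite mxE /flag_coef !insubT !mxE !enum_rankK /=.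
rewrite (_ : (k == l) = false) ?add0r; first by case: (M k l).
by apply/negbTE; rewrite -val_eqE neq_ltn (flag_pos_lt kl).
Qed.

Lemma flag_unip_unit M : flag_unip M -> M \in unitmx.
Proof.
move=> Mu; rewrite -unitmx_tr unitmxE det_trig.
  by rewrite big1 ?unitr1 // => k _; rewrite mxE Mu ?eqxx //;
    apply/negP => /flag_pos_lt; rewrite ltnn.
apply/is_trig_mxP => k l kl; rewrite mxE Mu; first by rewrite -val_eqE /= gtn_eqF.
by apply/negP => /flag_pos_lt; rewrite ltnNge (ltnW kl).
Qed.

(** The corner is again triangular with ones on the diagonal, so its determinant is 1. *)
Lemma flag_unip_corner M p : (p <= n)%N -> flag_unip M ->
  (pid_mx p : 'M[_]_(p, n)) *m M *m (pid_mx p : 'M[_]_(n, p)) \in unitmx.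
Proof.
move=> pn Mu; set N := _ *m _; have NE (k l : 'I_p) : N k l = M (widen_ord pn k) (widen_ord pn l).
  rewrite (@mulmx_pidE _ _ _ _ _ _ _ (widen_ord pn l)) //.
  have /rowP/(_ (widen_ord pn l)) := @row_pid_mxM _ _ _ _ k (widen_ord pn k) M (erefl _).
  by rewrite [LHS]mxE [RHS]mxE.
rewrite -unitmx_tr unitmxE det_trig.
  by rewrite big1 ?unitr1 // => k _; rewrite mxE NE Mu ?eqxx //;
    apply/negP => /flag_pos_lt; rewrite ltnn.
apply/is_trig_mxP => k l kl; rewrite mxE NE Mu; first by rewrite -val_eqE /= gtn_eqF.
by apply/negP => /flag_pos_lt; rewrite ltnNge /= (ltnW kl).
Qed.

(** The diagonal block containing row [k], named by the first subspace whose initial segment reaches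
    [k]; it is [None] for rows beyond all [d j]. *)
Definition flag_step (k : 'I_n) : option 'I_m :=
  [pick j : 'I_m | (k < d j)%N && [forall j', (k < d j')%N ==> (j <= j')%N]].

Lemma flag_stepP k : match flag_step k with
  | Some j => (k < d j)%N /\ forall j', (k < d j')%N -> (j <= j')%N
  | None => forall j, ~~ (k < d j)%N
  end.
Proof.
rewrite /flag_step; case: pickP => [j /andP[kj /forallP jmin]|none].
  by split=> // j' kj'; move: (jmin j'); rewrite kj'.
move=> j0; apply/negP => kj0.
have [j kj jmin] := @arg_minnP _ j0 (fun j => (k < d j)%N) (@nat_of_ord m) kj0.
by move: (none j); rewrite kj /= => /forallP; apply => j'; apply/implyP/jmin.
Qed.

Section Frame.
Variable E : 'M[C]_n.
Hypothesis Eu : E \in unitmx.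

Section Size.
Variable q : 'I_m -> nat.
Implicit Types B : forall i, 'M[C]_(q i, n).

(* A flag given by frames [B i] lies in the domain of the chart iff all
   [corner B i] are invertible; [normal_mx B] is then the matrix of its coordinates. *)
Definition corner B i : 'M[C]_(q i) := B i *m invmx E *m (pid_mx (d i) : 'M[_]_(n, q i)).

Definition normal_mx B : 'M[C]_n :=
  \matrix_(k, l) (if flag_step k is Some j then
     ((pid_mx (d j) : 'M[_]_(n, q j)) *m invmx (corner B j) *m (B j *m invmx E)) k l
   else (k == l)%:R).

End Size.

Implicit Types B : forall i, 'M[C]_(d i, n).

Lemma row_normal_mx B k j : flag_step k = Some j -> row k (normal_mx B) =
  row k ((pid_mx (d j) : 'M[_]_(n, d j)) *m invmx (corner B j) *m (B j *m invmx E)).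
Proof. by move=> kj; apply/rowP => l; rewrite mxE [LHS]mxE kj [RHS]mxE. Qed.

(** Multiplication by the inverse corner turns the first [d j] columns of $B_jE^{-1}$ into the
    identity. In a row of block [j] only the columns from [d j] on remain free. *)
Lemma normal_mx_unip B : (forall i, corner B i \in unitmx) -> flag_unip (normal_mx B).
Proof.
move=> Tu k l nkl; have := flag_stepP k; case kj: (flag_step k) => [j|].
  move=> [kdj _]; have ldj : (l < d j)%N.
    by rewrite ltnNge; apply: contra nkl => dl; apply/existsP; exists j; rewrite kdj.
  have : row k (normal_mx B) *m (pid_mx (d j) : 'M[_]_(n, d j)) =
         row k (pid_mx (d j) : 'M[_]_(n, d j)).
    by rewrite (row_normal_mx _ kj) -row_mul -!mulmxA (mulmxA (B j)) mulVmx ?mulmx1 ?Tu.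
  move/rowP/(_ (Ordinal ldj)); rewrite (@mulmx_pidE _ _ _ _ _ _ _ l) // !mxE /= => ->.
  by rewrite kdj andbT.
by move=> _; rewrite mxE kj.
Qed.

(** A row [k < d i] has step at most [i], so by monotonicity it yields a vector in the span of
    [B i]. Both sides have rank [d i], which gives equality. *)
Lemma normal_mx_flag B i : (forall i, corner B i \in unitmx) ->
  (forall i j : 'I_m, (i <= j)%N -> (B i <= B j)%MS) ->
  ((pid_mx (d i) : 'M[_]_(d i, n)) *m normal_mx B *m E :=: B i)%MS.
Proof.
move=> Tu Bmon; have Mu := flag_unip_unit (normal_mx_unip Tu).
apply/eqmxP; rewrite -mxrank_leqif_eq.
  rewrite mxrankMfree ?row_free_unit // (eqP (row_free_pid_mxM (d_le i) Mu)) eqn_leq rank_leq_row andbT.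
  have := mxrank_unit (Tu i); rewrite /corner => {1}<-.
  by rewrite (leq_trans (mxrankM_maxl _ _)) // mxrankM_maxl.
apply/row_subP => k; have kn : (k < n)%N by exact: leq_trans (ltn_ord k) (d_le i).
rewrite row_mul (@row_pid_mxM _ _ _ _ k (Ordinal kn)) //.
have := flag_stepP (Ordinal kn); case kj: (flag_step _) => [j|]; last first.
  by move/(_ i); rewrite /= ltn_ord.
move=> [_ /(_ i (ltn_ord k)) ji]; rewrite (row_normal_mx _ kj) -row_mul !mulmxA mulmxKV //.
by apply: submx_trans (row_sub _ _) _; apply: submx_trans (submxMl _ _) (Bmon _ _ ji).
Qed.

Lemma corner_flag_mx B x :
  (forall i, (B i :=: (pid_mx (d i) : 'M[_]_(d i, n)) *m flag_mx x *m E)%MS) ->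
  forall i, corner B i \in unitmx.
Proof.
move=> BX i; have Mu := flag_mx_unip x.
have /submxP[c cE] : (B i <= (pid_mx (d i) : 'M[_]_(d i, n)) *m flag_mx x *m E)%MS.
  by rewrite BX.
have cu : c \in unitmx.
  rewrite -row_free_unit /row_free eqn_leq rank_leq_row /=.
  have dB : (d i <= \rank (B i))%N.
    rewrite BX mxrankMfree ?row_free_unit // (eqP (row_free_pid_mxM (d_le i) _)) //.
    exact: flag_unip_unit.
  by apply: leq_trans dB _; rewrite cE -mulmxA mxrankM_maxl.
rewrite /corner cE mulmxA mulmxK // -mulmxA unitmx_mul cu /=.
exact: flag_unip_corner.
Qed.

(** Uniqueness of the coordinates: row [k] of block [j], multiplied by [E], is a combination of the
    rows of [B j]. Its first [d j] entries are those of the identity, and they determine the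
    coefficients because the corner is invertible. *)
Lemma normal_mx_flag_mx B x :
  (forall i, (B i :=: (pid_mx (d i) : 'M[_]_(d i, n)) *m flag_mx x *m E)%MS) ->
  normal_mx B = flag_mx x.
Proof.
move=> BX; have Tu := corner_flag_mx BX; apply/row_matrixP => k.
have := flag_stepP k; case kj: (flag_step k) => [j|]; last first.
  move=> nk; apply/rowP => l; rewrite mxE [RHS]mxE mxE kj flag_mx_unip //.
  by apply/negP => /existsP[j /andP[kj' _]]; move: (nk j); rewrite kj'.
move=> [kdj jmin].
have /submxP[a aE] : (row k (flag_mx x) *m E <= B j)%MS.
  rewrite BX submxMr // -(@row_pid_mxM _ _ _ _ (Ordinal kdj) k) //; exact: row_sub.
have vE : row k (flag_mx x) = a *m (B j *m invmx E) by rewrite mulmxA -aE mulmxK.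
have vT : row k (flag_mx x) *m (pid_mx (d j) : 'M[_]_(n, d j)) = row k (pid_mx (d j) : 'M[_]_(n, d j)).
  apply/rowP => l; pose l' := widen_ord (d_le j) l.
  rewrite (@mulmx_pidE _ _ _ _ _ _ _ l') // !mxE -/(flag_mx x k l') kdj andbT.
  rewrite -[LHS](_ : flag_mx x k l' = _); last by rewrite mxE.
  rewrite flag_mx_unip //; apply/existsP => -[j' /andP[kj' j'l]].
  have := leq_trans (d_mono (jmin j' kj')) j'l; rewrite leqNgt; case/negP.
  exact: (ltn_ord l).
have aT : a = row k (pid_mx (d j) : 'M[_]_(n, d j)) *m invmx (corner B j).
  have -> : row k (pid_mx (d j) : 'M[_]_(n, d j)) = a *m corner B j.
    by rewrite -vT vE /corner !mulmxA.
  by rewrite mulmxK.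
by rewrite (row_normal_mx _ kj) vE aT -!row_mul.
Qed.

End Frame.
End FlagCoordinates.

Section FlagSmooth.
Variables (R : realType) (m n : nat) (d : 'I_m -> nat).
Variables (E : 'M[R[i]]_n) (X : normedModType R) (q : 'I_m -> nat).
Variable B : X -> forall i : 'I_m, 'M[R[i]]_(q i, n).
Hypothesis B_smooth : forall i, msmooth [set: X] (fun x => B x i).

Definition corner_dom : set X := [set x | forall i, corner d E (B x) i \in unitmx].

Lemma corner_smooth i : msmooth [set: X] (fun x => corner d E (B x) i).
Proof.
have oT : open [set: X] by exact: openT.
by do 2!(apply: msmoothM => //; last exact: (msmooth_cst oT)).
Qed.

(** The domain is the set where the product of the corner determinants does not vanish. *)
Lemma corner_dom_open : open corner_dom.
Proof.
have oT : open [set: X] by exact: openT.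
have := csmooth_open_neq0 oT (csmooth_prod oT (index_enum _) predT
  (fun i => csmooth_det oT (@corner_smooth i))).
congr open; apply/seteqP; split=> x /=.
  move=> [_ /prodf_neq0 h] i; rewrite unitmxE unitfE; exact: h.
by move=> h; split=> //; apply/prodf_neq0 => i _; have := h i; rewrite unitmxE unitfE.
Qed.

Lemma normal_mx_smooth : msmooth corner_dom (fun x => normal_mx d E (B x)).
Proof.
have oD := corner_dom_open; have oT : open [set: X] by exact: openT.
have sub p r (F : X -> 'M[R[i]]_(p, r)) : msmooth [set: X] F -> msmooth corner_dom F.
  by move=> CF k l; apply: csmoothS (CF k l).
move=> k l; case kj: (flag_step d k) => [j|]; last first.
  by apply: (@csmooth_eq _ _ _ oD (fun=> (k == l)%:R)) => [x _|];
    [rewrite [RHS]mxE kj|exact: csmooth_cst].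
have Cst p r (A : 'M[R[i]]_(p, r)) : msmooth corner_dom (fun=> A).
  exact: (msmooth_cst oD).
have C : msmooth corner_dom (fun x => (pid_mx (d j) : 'M[_]_(n, q j)) *m
    invmx (corner d E (B x) j) *m (B x j *m invmx E)).
  apply: msmoothM => //; apply: msmoothM => //; last exact: sub.
  apply: (msmoothV oD) => [x xD|]; first exact: xD.
  by apply: sub; exact: corner_smooth.
by apply: (@csmooth_eq _ _ _ oD _ _ _ (C k l)) => x _; rewrite [RHS]mxE kj.
Qed.

Lemma flag_crd_smooth :
  smooth_on corner_dom (fun x => flag_crd d (normal_mx d E (B x))).
Proof.
have oD := corner_dom_open; apply: smooth_on_row => // k a.
pose s := val (enum_val a).
have [CR CI] := normal_mx_smooth s.1.1 s.1.2 k.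
case sb: s.2.
  apply: Ck_eq CR => // x _; rewrite [RHS]mxE -/s; move: sb; rewrite /s.
  by case: (val _) => -[k' l'] b /= ->.
apply: Ck_eq CI => // x _; rewrite [RHS]mxE -/s; move: sb; rewrite /s.
by case: (val _) => -[k' l'] b /= ->.
Qed.

End FlagSmooth.

Section FlagMxSmooth.
Variables (R : realType) (m n : nat) (d : 'I_m -> nat).
Local Notation K := #|{: flag_index n d}|.

Lemma row_entry_smooth N (a : 'I_N) k :
  Ck k [set: 'rV[R]_N] (fun x => x 0 a).
Proof.
have lin : linear (fun x : 'rV[R]_N => x 0 a) by move=> c u v; rewrite !mxE.
pose L := GRing.isLinear.Build _ _ _ _ _ lin.
pose g : {linear 'rV[R]_N -> R} := HB.pack (fun x : 'rV[R]_N => x 0 a) L.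
apply: (@Ck_lin _ _ _ openT _ k g); exact: coord_continuous.
Qed.

Lemma flag_mx_smooth : msmooth [set: 'rV[R]_K] (@flag_mx R m n d).
Proof.
have oT : open [set: 'rV[R]_K] by exact: openT.
move=> k l; apply: (@csmooth_eq _ _ _ oT (fun x => (k == l)%:R +
  (flag_coef x k l true +i* flag_coef x k l false))) => [x _|]; first by rewrite mxE.
apply: csmoothD => //; first exact: csmooth_cst.
have C b j : Ck j [set: 'rV[R]_K] (fun x => flag_coef x k l b).
  rewrite /flag_coef; case: insub => [s|]; first exact: row_entry_smooth.
  exact: Ck_cst.
by move=> j; split; exact: C.
Qed.

Lemma flag_mx0 : flag_mx (0 : 'rV[R]_K) = 1%:M.
Proof.
apply/matrixP => k l; rewrite !mxE /flag_coef.
have c0 b : (if insub (k, l, b) is Some s then (0 : 'rV[R]_K) 0 (enum_rank (s : flag_index n d)) else 0) = 0.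
  by case: insub => // s; rewrite mxE.
by rewrite !c0 -[X in _ + X]/(0 : R[i]) addr0.
Qed.

End FlagMxSmooth.

(** * Real coordinates on tuples of linear maps *)

Section HomUncoord.
Variables (R : realType) (m : nat) (A B : 'I_m -> vectType R[i]).
Local Notation N := #|{: hom_index A B}|.
Local Notation tg i x := (Tagged (fun i => ('I_(\dim {:A i}) * 'I_(\dim {:B i}) * bool)%type) (x : 'I_(\dim {:A i}) * 'I_(\dim {:B i}) * bool) : hom_index A B).

Definition hom_entries (y : 'rV[R]_N) i : 'M[R[i]]_(\dim {:A i}, \dim {:B i}) :=
  \matrix_(a, b) (y 0 (enum_rank (tg i (a, b, true))) +i* y 0 (enum_rank (tg i (a, b, false)))).

Definition hom_uncoord (y : 'rV[R]_N) i : 'Hom(A i, B i) :=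
  hommx (vbasis {:A i}) (vbasis {:B i}) (hom_entries y i).

Lemma mxof_uncoord y i :
  mxof (vbasis {:A i}) (vbasis {:B i}) (hom_uncoord y i) = hom_entries y i.
Proof. by rewrite hommxK ?vbasisP. Qed.

Lemma hom_coordK f : hom_uncoord (hom_coord f) = f.
Proof.
apply: functional_extensionality_dep => i; rewrite /hom_uncoord.
rewrite -[RHS](mxofK (vbasisP {:A i}) (vbasisP {:B i})); congr hommx.
apply/matrixP => a b; rewrite mxE ![hom_coord _ _ _]mxE !enum_rankK /=.
by case: (mxof _ _ _ _ _).
Qed.

Lemma hom_entries_smooth i : msmooth [set: 'rV[R]_N] (fun y => hom_entries y i).
Proof.
have oT : open [set: 'rV[R]_N] by exact: openT.
move=> a b; apply: (@csmooth_eq _ _ _ oT (fun y => y 0 (enum_rank (tg i (a, b, true))) +i*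
  y 0 (enum_rank (tg i (a, b, false))))) => [y _|]; first by rewrite mxE.
by move=> k; split; exact: row_entry_smooth.
Qed.

Lemma hom_coord_smooth (X : normedModType R) (f : X -> forall i, 'Hom(A i, B i)) :
  (forall i, msmooth [set: X] (fun x => mxof (vbasis {:A i}) (vbasis {:B i}) (f x i))) ->
  smooth_on [set: X] (fun x => hom_coord (f x)).
Proof.
move=> fS; apply: smooth_on_row => [|k a]; first exact: openT.
have hE x : hom_coord (f x) 0 a = let s := enum_val a in
    let z := mxof (vbasis {:A (tag s)}) (vbasis {:B (tag s)}) (f x (tag s))
               (tagged s).1.1 (tagged s).1.2 in
    if (tagged s).2 then complex.Re z else complex.Im z.
  by rewrite mxE; case: (enum_val a) => i [[a' b'] c].
have oT : open [set: X] by exact: openT.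
apply: (Ck_eq oT (fun x _ => esym (hE x))) => /=.
have [CR CI] := fS (tag (enum_val a)) (tagged (enum_val a)).1.1 (tagged (enum_val a)).1.2 k.
by case: (tagged (enum_val a)).2.
Qed.

End HomUncoord.

(** * The chart shared by both manifolds *)

Section FlagChart.
Variables (R : realType) (m : nat) (H : hermSpace R) (d : 'I_m -> nat).
Local Notation C := R[i].
Local Notation n := (\dim {:H}).
Local Notation K := #|{: flag_index n d}|.
Hypothesis d_mono : forall i j : 'I_m, (i <= j)%N -> (d i <= d j)%N.
Hypothesis d_le : forall i, (d i <= n)%N.
Variable E : 'M[C]_n.
Hypothesis Eu : E \in unitmx.

Definition std_frame (x : 'rV[R]_K) i : 'M[C]_(d i, n) :=
  (pid_mx (d i) : 'M[_]_(d i, n)) *m flag_mx x *m E.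

(** Parametrization of the cell of flags around the one spanned by the initial segments of [E],
    which is the value at [x = 0]. *)
Definition std_flag (x : 'rV[R]_K) (i : 'I_m) : {vspace H} := limg (rowhom (std_frame x i)).

Lemma std_frame_free x i : row_free (std_frame x i).
Proof.
rewrite /std_frame -mulmxA; apply: row_free_pid_mxM => //.
by rewrite unitmx_mul Eu andbT; apply/flag_unip_unit/flag_mx_unip.
Qed.

Lemma std_frame_mono x (i j : 'I_m) : (i <= j)%N -> (std_frame x i <= std_frame x j)%MS.
Proof.
by move=> ij; rewrite /std_frame -!mulmxA -(pid_mxM _ (d_mono ij) (d_le j)) submxMl.
Qed.

Lemma std_flag_flags x : flags d (std_flag x).
Proof.
split=> [i j ij|i]; first by rewrite limg_rowhom_sub; exact: std_frame_mono.
by rewrite dim_rowhom; apply/eqP/std_frame_free.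
Qed.

Lemma normal_mx_std (q : 'I_m -> nat) (B : forall i, 'M[C]_(q i, n)) x :
  (forall i, q i = d i) -> (forall i, B i :=: std_frame x i)%MS ->
  (forall i, corner d E B i \in unitmx) /\ flag_crd d (normal_mx d E B) = x.
Proof.
(* In the applications [q i] is the dimension of the source of a frame, which may equal [d i] only
   up to a proof; [q] is a variable so that [subst] can identify the two. *)
move=> hq; have qd : q = d by exact: functional_extensionality_dep.
subst q; move=> BX; split.
  exact: (corner_flag_mx d_le Eu BX).
by rewrite (normal_mx_flag_mx d_mono d_le Eu BX) flag_mxK.
Qed.

Lemma std_normal_mx (q : 'I_m -> nat) (B : forall i, 'M[C]_(q i, n)) :
  (forall i, q i = d i) -> (forall i j : 'I_m, (i <= j)%N -> (B i <= B j)%MS) ->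
  (forall i, corner d E B i \in unitmx) ->
  forall i, (std_frame (flag_crd d (normal_mx d E B)) i :=: B i)%MS.
Proof.
move=> hq; have qd : q = d by exact: functional_extensionality_dep.
subst q; move=> Bmon Bu i.
rewrite /std_frame flag_crdK; last exact: normal_mx_unip.
exact: normal_mx_flag.
Qed.

Lemma std_flag_inj : injective std_flag.
Proof.
move=> x y xy.
have [_ <-] := @normal_mx_std d (std_frame x) x (fun=> erefl) (fun i => eqmx_refl _).
by have [_ ->] := @normal_mx_std d (std_frame x) y (fun=> erefl) (fun i => limg_rowhom_eq (congr1 (fun F => F i) xy)).
Qed.

Definition flag_dom : set ('I_m -> {vspace H}) := range std_flag.

(** The inverse of [std_flag] on its range [flag_dom]; the default 0 is taken only outside. *)
Definition flag_phi (W : 'I_m -> {vspace H}) : 'rV[R]_K := xget 0 [set x | std_flag x = W].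

Lemma std_flagK : cancel std_flag flag_phi.
Proof.
move=> x; rewrite /flag_phi; case: xgetP => [y _ /= /std_flag_inj //|].
by move/(_ x); case.
Qed.

Lemma flag_phi_inj : set_inj flag_dom flag_phi.
Proof.
move=> _ _ /set_mem[x _ <-] /set_mem[y _ <-] xy; congr std_flag.
exact: etrans (esym (std_flagK x)) (etrans xy (std_flagK y)).
Qed.

Section Frames.
Variables (A : 'I_m -> vectType C) (b : forall i, 'Hom(A i, H)).
Hypothesis dimA : forall i, \dim {:A i} = d i.
Hypothesis b_mono : forall i j : 'I_m, (i <= j)%N -> (limg (b i) <= limg (b j))%VS.
Let B i : 'M[C]_(\dim {:A i}, n) := lmx (b i).

(** Read on any frame of the flag, the chart domain becomes an open condition, and by [flag_phiE]
    the coordinates become a smooth function. The sources [A i] are arbitrary, to cover both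
    ['rV_(d i)] and [V i]. *)
Lemma flag_domP : flag_dom (fun i => limg (b i)) <-> forall i, corner d E B i \in unitmx.
Proof.
split=> [[x _ bx]|Bu].
  have BX i : (B i :=: std_frame x i)%MS.
    by apply: limg_rowhom_eq; rewrite -limg_rowhom -(congr1 (fun F => F i) bx).
  by have [] := normal_mx_std dimA BX.
exists (flag_crd d (normal_mx d E B)) => //; apply: functional_extensionality_dep => i.
rewrite limg_rowhom; apply: eqmx_rowhom; apply: std_normal_mx => // i' j ij.
by rewrite -limg_sub b_mono.
Qed.

Lemma flag_phiE : flag_dom (fun i => limg (b i)) ->
  flag_phi (fun i => limg (b i)) = flag_crd d (normal_mx d E B).
Proof.
move=> [x _ bx]; rewrite -bx std_flagK.
have BX i : (B i :=: std_frame x i)%MS.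
  by apply: limg_rowhom_eq; rewrite -limg_rowhom -(congr1 (fun F => F i) bx).
by have [_ ->] := normal_mx_std dimA BX.
Qed.

End Frames.

Lemma std_frame_smooth i : msmooth [set: 'rV[R]_K] (fun x => std_frame x i).
Proof.
have oT : open [set: 'rV[R]_K] by exact: openT.
apply: msmoothM => //; last exact: (msmooth_cst oT).
apply: msmoothM => //; first exact: (msmooth_cst oT).
exact: flag_mx_smooth.
Qed.

(* Charts of both manifolds pull back along the same map [flag_phi]. *)
Section QuotientChart.
Variables (A B : 'I_m -> vectType C).
Let cc := @hom_coord R m A B.
Variables (T : Type) (Z : set (forall i, 'Hom(A i, B i))) (p : (forall i, 'Hom(A i, B i)) -> T).
Variable flagT : T -> 'I_m -> {vspace H}.

Definition pullback_chart : chart R T :=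
  Chart [set o | (p @` Z) o /\ flag_dom (flagT o)] (fun o => flag_phi (flagT o)).

Lemma pullback_chart_img : (forall x, exists2 o, (p @` Z) o & flagT o = std_flag x) ->
  chart_map pullback_chart @` chart_dom pullback_chart = setT.
Proof.
move=> onto; apply/seteqP; split=> // x _; have [u Zu ux] := onto x.
by exists u; [split=> //; rewrite ux; exists x|rewrite /= ux std_flagK].
Qed.

Variables (A' : 'I_m -> vectType C) (b : (forall i, 'Hom(A i, B i)) -> forall i, 'Hom(A' i, H)).
Hypothesis dimA' : forall i, \dim {:A' i} = d i.
Hypothesis pE : forall z, Z z -> flagT (p z) = fun i => limg (b z i).
Hypothesis b_mono : forall z, Z z -> forall i j : 'I_m, (i <= j)%N ->
  (limg (b z i) <= limg (b z j))%VS.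
Hypothesis flagT_inj : set_inj (p @` Z) flagT.
Hypothesis b_smooth : forall i,
  msmooth setT (fun y => lmx (b (hom_uncoord y) i)).
Variable s : 'rV[R]_K -> forall i, 'Hom(A i, B i).
Hypothesis s_Z : forall x, Z (s x).
Hypothesis s_flag : forall x, flagT (p (s x)) = std_flag x.
Hypothesis s_smooth : forall i,
  msmooth setT (fun x => mxof (vbasis {:A i}) (vbasis {:B i}) (s x i)).

(** The corners and the normalized matrix of the frames [b z] make sense on the ambient coordinate
    space: their domain [O] gives quotient openness, and their formula extends the chart smoothly
    off [Z]. The map [s] is a smooth section over the whole image of the chart. *)
Lemma quotient_pullback_chart : quotient_chart cc Z p pullback_chart.
Proof.
pose O := corner_dom d E (fun y i => lmx (b (hom_uncoord y) i)).
have OE z : Z z -> flag_dom (flagT (p z)) <-> O (cc z).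
  move=> Zz; rewrite pE // /O /corner_dom /= hom_coordK.
  by apply: flag_domP => //; exact: b_mono.
split.
- by move=> o [].
- exists O => [|z Zz]; first exact: corner_dom_open.
  by rewrite -OE //; split=> [[]//|]; split=> //; exists z.
- move=> o o' /set_mem[Zo Uo] /set_mem[Zo' Uo'] /= /flag_phi_inj.
  by move=> /(_ (mem_set Uo) (mem_set Uo')) /flagT_inj; apply; exact: mem_set.
- rewrite pullback_chart_img; first exact: openT.
  by move=> x; exists (p (s x)); [exists (s x)|].
split=> [z [Zz [_ Uz]]|o [Zo Uo]].
  exists O, (fun y => flag_crd d (normal_mx d E (fun i => lmx (b (hom_uncoord y) i)))).
  split; [exact/OE|exact: flag_crd_smooth|].
  move=> z' [Zz' [_ Uz']] _ /=; rewrite hom_coordK pE // flag_phiE // -?pE //.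
exists setT, (fun x => cc (s x)); split=> //; first exact: hom_coord_smooth.
move=> x _; exists (s x); split=> //; last by rewrite /= s_flag std_flagK.
by split; [exists (s x)|rewrite s_flag; exists x].
Qed.

End QuotientChart.
End FlagChart.

Section FlagChartAt.
Variables (R : realType) (m : nat) (H : hermSpace R) (d : 'I_m -> nat).
Local Notation C := R[i].
Local Notation n := (\dim {:H}).

Lemma flags_bounds (W : 'I_m -> {vspace H}) : flags d W ->
  (forall i j : 'I_m, (i <= j)%N -> (d i <= d j)%N) /\ (forall i, (d i <= n)%N).
Proof.
move=> [Wmon Wd]; split=> [i j ij|i]; rewrite -!Wd; first exact/dimvS/Wmon.
exact/dimvS/subvf.
Qed.

Lemma flags_adapted (W : 'I_m -> {vspace H}) : flags d W ->
  exists2 E : 'M[C]_n, E \in unitmx & std_flag E (0 : 'rV[R]_#|{: flag_index n d}|) = W.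
Proof.
(* The matrix of the projection onto [W i] has [W i] as row space, so [adapted_basis] applies. *)
move=> [Wmon Wd]; pose M i : 'M[C]_n := lmx (projv (W i)).
have Mmon (i j : 'I_m) : (i <= j)%N -> (M i <= M j)%MS.
  move=> ij; rewrite -(limg_sub (projv (W i)) (projv (W j))).
  exact: etrans (congr2 (fun A B => A <= B)%VS (limg_proj (W i)) (limg_proj (W j))) (Wmon i j ij).
have Md i : \rank (M i) = d i by rewrite -dim_limg limg_proj.
have [E Eu EM] := adapted_basis Mmon Md.
exists E => //; apply: functional_extensionality_dep => i.
rewrite -[RHS]limg_proj limg_rowhom; apply: eqmx_rowhom.
by rewrite /std_frame flag_mx0 mulmx1; exact: EM.
Qed.

Variables (E : 'M[C]_n) (Eu : E \in unitmx).
Hypothesis d_mono : forall i j : 'I_m, (i <= j)%N -> (d i <= d j)%N.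
Hypothesis d_le : forall i, (d i <= n)%N.
Let p (b : frames d H) i := limg (b i).

(** Here the points of [Z] are themselves the frames, and [std_frame] provides the section. *)
Lemma flag_chart_atlas :
  atlas (flag_manifold d H) (pullback_chart d E (flag_frames (V := H)) p id).
Proof.
apply: (@quotient_pullback_chart _ _ _ _ d_mono d_le _ Eu _ _ _ _ _ _ _ (fun b => b) _ _ _ _ _
  (fun x i => rowhom (std_frame E x i))) => //.
- by move=> i; rewrite dimvf dim_matrix; exact: mul1n.
- by move=> b [_ bmon] i j; exact: bmon.
- move=> i; apply: (@msmooth_eq _ _ _ openT _ _ (fun y => hom_entries y i *m onbmx H)).
    by move=> y _; rewrite -mxof_uncoord mxof_lmx mulmxKV ?onbmx_unit.
  apply: msmoothM; [exact: openT|exact: hom_entries_smooth|exact: (msmooth_cst openT)].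
- move=> x; split=> [i|i j ij]; first exact/rowhom_inj/std_frame_free.
  by rewrite limg_rowhom_sub; exact: std_frame_mono.
- move=> i.
  pose c : 'M[C]_(\dim {:'rV[C]_(d i)}, d i) := \matrix_a (vbasis {:'rV[C]_(d i)})`_a.
  apply: (@msmooth_eq _ _ _ openT _ _ (fun x => c *m std_frame E x i *m invmx (onbmx H))).
    by move=> x _; rewrite mxof_lmx lmx_rowhomE.
  apply: msmoothM; [exact: openT| |exact: (msmooth_cst openT)].
  apply: msmoothM; [exact: openT|exact: (msmooth_cst openT)|exact: std_frame_smooth].
Qed.

Lemma flag_chart_dom W :
  chart_dom (pullback_chart d E (flag_frames (V := H)) p id) W <-> flag_dom d E W.
Proof.
split=> [[] //|[x _ <-]]; split; last by exists x.
exists (fun i => rowhom (std_frame E x i)) => //; split=> [i|i j ij].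
  exact/rowhom_inj/std_frame_free.
by rewrite limg_rowhom_sub; exact: std_frame_mono.
Qed.

End FlagChartAt.

(** * Charts of the symplectic quotient *)

Section Quotient.
Variables (R : realType) (m : nat) (V : nat -> hermSpace R) (t : 'I_m -> R).
Hypothesis t_gt0 : forall i, 0 < t i.
Local Notation C := R[i].
Local Notation D k := (\dim {: V k}).
Let d (i : 'I_m) := D i.
Local Notation H := (V m).
Local Notation n := (D m).
Let Z : set (repF m V) := [set f | forall i, mu t f i = 0].

Lemma moment_fibre_flags f : Z f -> flags d (flag_of f).
Proof.
move=> /(normal_form t_gt0)[E fE].
have En : row_free (E m) by rewrite row_free_unit unitarymx_unit // fE.1.
have Dm (i : 'I_m) : (D i <= n)%N by exact: (framed_dim fE (ltnW (ltn_ord i))).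
split=> [i j ij|i]; rewrite !(flag_framed t_gt0 _ fE).
  rewrite limg_rowhom_sub -(pid_mxM (E m) (framed_dim fE ij (ltnW (ltn_ord j))) (Dm j)).
  exact: submxMl.
rewrite dim_rowhom; apply/eqP/row_free_pid_mxM => //.
by rewrite -row_free_unit.
Qed.

Section Chart.
Variables (E : 'M[C]_n) (Eu : E \in unitmx).
Hypothesis d_mono : forall i j : 'I_m, (i <= j)%N -> (d i <= d j)%N.
Hypothesis d_le : forall i, (d i <= n)%N.
Local Notation K := #|{: flag_index n d}|.

(* All bases are standard except that of [V m]: only the last arrow varies. *)
Definition chart_frame (x : 'rV[R]_K) : forall k, 'M[C]_(D k) :=
  @eqtype.dfwith nat (fun k => 'M[C]_(D k) : Type) (fun k => 1%:M) m (gs (@flag_mx R m n d x *m E)).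

Definition chart_section (x : 'rV[R]_K) : repF m V :=
  fun i => nhom (stdmx V t i *m chart_frame x i.+1).

Lemma flag_mxE_unit x : @flag_mx R m n d x *m E \in unitmx.
Proof. by rewrite unitmx_mul Eu andbT; apply/flag_unip_unit/flag_mx_unip. Qed.

Lemma chart_section_framed x : framed t (chart_section x) (chart_frame x).
Proof.
split=> [k km|k km].
  rewrite /chart_frame; have [->|k_m] := eqVneq k m.
    by rewrite eqtype.dfwith_in; apply/gs_unitary/flag_mxE_unit.
  rewrite eqtype.dfwith_out 1?eq_sym //.
  by apply/unitarymxP; rewrite mul1mx trmx1 map_mx1.
pose i := Ordinal km; split.
  have := km; rewrite leq_eqVlt => /orP[/eqP ->|k1m]; first exact: (d_le i).
  exact: (d_mono (i := i) (j := Ordinal k1m)).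
rewrite /amx /arrow -[k]/(i : nat) extend_ord nhomK {1}/chart_frame eqtype.dfwith_out ?mul1mx //.
by rewrite gtn_eqF.
Qed.

Lemma chart_section_mu x : Z (chart_section x).
Proof. exact: (framed_mu t_gt0 (chart_section_framed x)). Qed.

(** Gram-Schmidt does not change the spans of the initial segments. *)
Lemma chart_section_flag x : flag_of (chart_section x) = std_flag E x.
Proof.
apply: functional_extensionality_dep => i.
rewrite (flag_framed t_gt0 i (chart_section_framed x)); apply: eqmx_rowhom.
rewrite /chart_frame eqtype.dfwith_in /std_frame -mulmxA.
exact: (gs_flag (flag_mxE_unit x) (d_le i)).
Qed.

Lemma chart_frame_smooth k : msmooth [set: 'rV[R]_K] (fun x => chart_frame x k).
Proof.
have oT : open [set: 'rV[R]_K] by exact: openT.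
have [->|km] := eqVneq k m.
  apply: (@msmooth_eq _ _ _ oT _ _ (fun x => gs (@flag_mx R m n d x *m E))) => [x _|].
    by rewrite /chart_frame eqtype.dfwith_in.
  apply: msmooth_gs => // [x _|]; first exact: flag_mxE_unit.
  by apply: msmoothM => //; [exact: flag_mx_smooth|exact: (msmooth_cst oT)].
apply: (@msmooth_eq _ _ _ oT _ _ (fun=> 1%:M)) => [x _|]; last exact: (msmooth_cst oT).
by rewrite /chart_frame eqtype.dfwith_out // eq_sym.
Qed.

End Chart.

Lemma comp_arrows_smooth i j : (i <= j)%N -> msmooth setT
  (fun y => nmx (comp_arrows (hom_uncoord (A := fun i : 'I_m => V i) (B := fun i : 'I_m => V i.+1) y) i j)).
Proof.
set N := #|_|; have oT : open [set: 'rV[R]_N] by exact: openT.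
elim: j => [|j IHj].
  rewrite leqn0 => /eqP ->.
  apply: (@msmooth_eq _ _ _ oT _ _ (fun=> nmx \1%VF)) => [y _|]; last exact: (msmooth_cst oT).
  by rewrite comp_arrows_id.
rewrite leq_eqVlt => /orP[/eqP ->|ij].
  apply: (@msmooth_eq _ _ _ oT _ _ (fun=> nmx \1%VF)) => [y _|]; last exact: (msmooth_cst oT).
  by rewrite comp_arrows_id.
pose a y := arrow (hom_uncoord (A := fun i : 'I_m => V i) (B := fun i : 'I_m => V i.+1) y) j.
apply: (@msmooth_eq _ _ _ oT _ _ (fun y => nmx (comp_arrows (hom_uncoord y) i j) *m nmx (a y))).
  by move=> y _; rewrite comp_arrowsS // nmx_comp.
apply: (msmoothM oT); first exact: IHj.
have [jm|mj] := ltnP j m; last first.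
  apply: (@msmooth_eq _ _ _ oT _ _ (fun=> 0)) => [y _|]; last exact: (msmooth_cst oT).
  by rewrite /a /arrow extend_ge // linear0.
rewrite /a /arrow -[j]/(Ordinal jm : nat).
apply: (@msmooth_eq _ _ _ oT _ _ (fun y =>
  invmx (onbmx (V j)) *m (hom_entries y (Ordinal jm) *m onbmx (V j.+1)))).
  by move=> y _; rewrite extend_ord nmxE lmxE mxof_uncoord.
apply: (msmoothM oT); first exact: (msmooth_cst oT).
apply: (msmoothM oT); last exact: (msmooth_cst oT).
exact: (@hom_entries_smooth R m (fun i : 'I_m => V i) (fun i : 'I_m => V i.+1) (Ordinal jm)).
Qed.

(** The induced map on orbits, through a chosen representative; by [flag_orbit] the choice does not
    matter. *)
Definition class_flag (o : set (repF m V)) : 'I_m -> {vspace H} :=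
  if pselect (exists f, o f) is left e then flag_of (projT1 (cid e)) else fun=> 0%VS.

Lemma class_flag_orbit f : class_flag (orbit f) = flag_of f.
Proof.
rewrite /class_flag; case: pselect => [e|]; last by case; exists f; exact: orbit_refl.
by case: cid => f' /= /flag_orbit.
Qed.

Lemma class_flag_inj : set_inj (@orbit R m V @` Z) class_flag.
Proof.
move=> _ _ /set_mem[f Zf <-] /set_mem[f' Zf' <-]; rewrite !class_flag_orbit.
exact: flag_of_inj.
Qed.

(** Here the frames are the composed arrows from [V i] to [V m], polynomial in the entries of [f],
    and [chart_section] provides the section. *)
Lemma moment_chart_atlas (E : 'M[C]_n) : E \in unitmx ->
  (forall i j : 'I_m, (i <= j)%N -> (d i <= d j)%N) -> (forall i, (d i <= n)%N) ->
  atlas (symplectic_quotient V t) (pullback_chart d E Z (@orbit R m V) class_flag).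
Proof.
move=> Eu d_mono d_le.
apply: (@quotient_pullback_chart _ _ _ _ d_mono d_le _ Eu _ _ _ _ _ _ _
  (fun f i => comp_arrows f i m) _ _ _ _ _ (chart_section E)) => //.
- by move=> f _; rewrite class_flag_orbit.
- by move=> f /moment_fibre_flags[]; exact.
- exact: class_flag_inj.
- move=> i; have oT := @openT 'rV[R]_#|{: hom_index (fun i : 'I_m => V i) (fun i : 'I_m => V i.+1)}|.
  apply: (@msmooth_eq _ _ _ oT _ _ (fun y => onbmx (V i) *m nmx (comp_arrows (hom_uncoord y) i m))).
    by move=> y _; rewrite nmxE mulKVmx ?onbmx_unit.
  apply: (msmoothM oT); first exact: (msmooth_cst oT).
  exact: comp_arrows_smooth (ltnW (ltn_ord i)).
- exact: chart_section_mu.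
- by move=> x; rewrite class_flag_orbit chart_section_flag.
- move=> i; apply: (@msmooth_eq _ _ _ openT _ _ (fun x =>
    onbmx (V i) *m (stdmx V t i *m chart_frame E x i.+1) *m invmx (onbmx (V i.+1)))).
    by move=> x _; rewrite mxof_nmx nhomK.
  apply: msmoothM; [exact: openT| |exact: (msmooth_cst openT)].
  apply: msmoothM; [exact: openT|exact: (msmooth_cst openT)|].
  apply: msmoothM; [exact: openT|exact: (msmooth_cst openT)|exact: chart_frame_smooth].
Qed.

End Quotient.

Lemma smooth_on_id (R : realType) (E : normedModType R) : smooth_on [set: E] (@id E).
Proof.
split=> [|k]; first exact: openT.
by apply: (@Ck_lin _ _ _ openT _ k (@idfun E : {linear E -> E})) => x; exact: cvg_id.
Qed.

Theorem proposition1p2 (R : realType) (m : nat) (V : nat -> hermSpace R)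
    (t : 'I_m -> R) (m_ge1 : (1 <= m)%N) (t_gt0 : forall i, 0 < t i) :
  (forall f : repF m V,
     (semistable t f <-> stable t f) /\
     (stable t f <-> forall i, injective (f i))) /\
  (exists h : set (repF m V) -> 'I_m -> {vspace V m},
     (forall f : repF m V, (forall i, mu t f i = 0) ->
        h (orbit f) = flag_of f) /\
     diffeomorphism (symplectic_quotient V t)
       (flag_manifold (fun i : 'I_m => \dim {: V i}) (V m)) h).
Proof.
split=> [f|].
  have sss : stable t f -> semistable t f by move=> fs xi xiH xi0 /(fs xi xiH xi0)/ltW.
  have inj : semistable t f -> forall i, injective (f i) by exact: semistable_injective.
  have st : (forall i, injective (f i)) -> stable t f by exact: injective_stable.
  by split; [split=> [/inj/st|/sss]|split=> [/sss/inj|/st]].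
pose d (i : 'I_m) := \dim {: V i}.
pose Z : set (repF m V) := [set f | forall i, mu t f i = 0].
pose h := @class_flag R m V.
have hE f : h (orbit f) = flag_of f by exact: class_flag_orbit.
(* A flag [W] has coordinate 0 in the chart of a basis adapted to it, so the section at 0 is a
   preimage. *)
have onto W : flags d W -> exists2 f, Z f & flag_of f = W.
  move=> Wf; have [d_mono d_le] := flags_bounds Wf; have [E Eu EW] := flags_adapted Wf.
  exists (chart_section t E 0); first exact: chart_section_mu.
  by rewrite chart_section_flag.
(* The inverse sends a flag to the orbit of a chosen point of the zero fibre above it; [flag_of_inj]
   makes the orbit independent of this choice. *)
pose h' W : set (repF m V) := if pselect (exists2 f, Z f & flag_of f = W) is left e
  then orbit (projT1 (cid2 e)) else set0.
have h'E f : Z f -> h' (flag_of f) = orbit f.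
  move=> Zf; rewrite /h'; case: pselect => [e|]; last by case; exists f.
  case: cid2 => f' /= Zf' ff'; exact: (flag_of_inj t_gt0).
pose qc E := pullback_chart d E Z (@orbit R m V) h.
pose fc E := pullback_chart d E (flag_frames (V := V m)) (fun (b : frames d (V m)) i => limg (b i)) id.
have charts W : flags d W -> exists E, [/\ atlas (symplectic_quotient V t) (qc E),
    atlas (flag_manifold d (V m)) (fc E), chart_dom (fc E) W,
    forall W', chart_dom (fc E) W' <-> flags d W' /\ flag_dom d E W' &
    chart_map (qc E) @` chart_dom (qc E) = setT /\
    chart_map (fc E) @` chart_dom (fc E) = setT].
  move=> Wf; have [d_mono d_le] := flags_bounds Wf; have [E Eu EW] := flags_adapted Wf.
  have fcP W' : chart_dom (fc E) W' <-> flags d W' /\ flag_dom d E W'.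
    split=> [/(flag_chart_dom Eu d_mono d_le)[x _ <-]|[_ W'd]]; last exact/flag_chart_dom.
    by split; [exact: (std_flag_flags d_mono d_le Eu)|exists x].
  exists E; split=> //.
  - exact: moment_chart_atlas.
  - exact: flag_chart_atlas.
  - by apply/fcP; split=> //; exists 0.
  have std (x : 'rV[R]_#|{: flag_index (\dim {: V m}) d}|) : flags d (std_flag E x) by exact: (std_flag_flags d_mono d_le Eu).
  split; apply: pullback_chart_img => // x.
    by have [f Zf fx] := onto _ (std x); exists (orbit f); [exists f|rewrite hE].
  by exists (std_flag E x) => //; have [] := (fcP (std_flag E x)).2 (conj (std x) (ex_intro2 _ _ x I erefl)).
exists h; split=> [f _|]; first exact: hE.
split.
- split.
  + by move=> _ [f Zf <-]; rewrite hE; exact: moment_fibre_flags.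
  + exact: (class_flag_inj t_gt0).
  + by move=> W /onto[f Zf <-]; exists (orbit f); [exists f|exact: hE].
- move=> _ [f Zf <-].
  have [E [qa fa /= [_ Wd] fd [qT _]]] := charts _ (moment_fibre_flags t_gt0 Zf).
  exists (qc E), (fc E); split=> //.
  + by split; [exists f|rewrite hE].
  + move=> o [[f' Zf' <-] od]; apply/fd; split=> //; rewrite hE.
    exact: moment_fibre_flags.
  (* Both charts read the coordinates of the same flag, so [h] is the identity in coordinates. *)
  + by exists id; rewrite qT; split=> //; exact: smooth_on_id.
exists h' => [_ [f Zf <-]|W Wf]; first by rewrite hE h'E.
have [E [qa fa Wd fd [_ fT]]] := charts _ Wf.
have h'K W' : flags d W' -> (@orbit R m V @` Z) (h' W') /\ h (h' W') = W'.
  by move=> /onto[f Zf <-]; rewrite h'E // hE; split=> //; exists f.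
exists (fc E), (qc E); split=> //.
  by move=> W' /fd[/h'K[Zh hW'] W'd]; split=> //; rewrite hW'.
exists id; rewrite fT; split=> [|W' /fd[/h'K[_ hW'] _]]; first exact: smooth_on_id.
by rewrite /= hW'.
Qed.
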